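(* For a word $v=X_1X_2\ldots X_n$ of letters $X_i\in\{\mathtt L,\mathtt R\}$, the closed broken line $\overline P_v$ (obtained by folding paper according to $v$) is isometric to the path $\rho_v'$ going around the graph $\Sigma_{1,v}'$ (the lift to $\mathbb C$ of the Schreier graph $\Sigma_{1,v}$).
   Context: Groups. Over an ordered alphabet, $g=\sigma_g(g_1,\dots,g_d)$ means the tree automorphism $g(x_iu)=x_{\sigma_g(i)}g_i(u)$; right factors act first. Let $\sigma=(12)(34)$ and, over the ordered alphabet $(\mathtt L_0,\mathtt L_1,\mathtt R_0,\mathtt R_1)$, let $\alpha_1=\sigma(\beta_1,\beta_1,\beta_1\alpha_1,\alpha_1\beta_1)$, $\beta_1=(1,\beta_1\alpha_1\beta_1,\alpha_1,1)$, $\gamma_1=(\gamma_1,\beta_1,\gamma_1,\beta_1)$, $\alpha_2=\sigma(\beta_2\alpha_2,\alpha_2\beta_2,\beta_2,\beta_2)$, $\beta_2=(\alpha_2,1,1,\beta_2\alpha_2\beta_2)$, $\gamma_2=(\gamma_2,\beta_2,\gamma_2,\beta_2)$. Let $A=\alpha_2$, $B=\beta_1\beta_2$, $C=\gamma_1\gamma_2$; then $\alpha_1=CAB$. The group $\mathcal H=\langle A,B,C\rangle$ is isomorphic to the group of all affine maps $z\mapsto\pm z+q$, $q\in\mathbb Z[i]$, acting on $\mathbb C$ from the right, via $z\cdot A=-z+1$, $z\cdot B=-z+1+i$, $z\cdot C=-z$. Graphs. Let $\xi=\frac{1+i}{4}$ and let $\Sigma_1$ be the left Cayley graph of $\mathcal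 H$ drawn in $\mathbb C$ with vertex set $\xi\cdot\mathcal H$ and straight edges joining $\xi\cdot h$ with $\xi\cdot gh$ (the $g$-edges) for $h\in\mathcal H$, $g\in\{A,B,C,CAB\}$. Let $\mathcal H_n<\mathcal H$ be the subgroup of maps $z\mapsto\pm z+q$ with $q$ divisible by $(1+i)^n$. For $v=X_1\ldots X_n$ let $E_v$ be the set of words $Y_1\ldots Y_n$ with $Y_k\in\{(X_k)_0,(X_k)_1\}$ (it is invariant under all the automorphisms above), and let $w_0=(X_1)_0\ldots(X_n)_0$. The map $h(w_0)\mapsto\xi\cdot h\cdot\mathcal H_n$ is a bijection from $E_v$ to the set of vertices of $\Sigma_1/\mathcal H_n\subset\mathbb C/\mathcal H_n$. $\Sigma_{1,v}$ is the simplicial Schreier graph (loops omitted) of $\langle\alpha_1,\beta_1,\gamma_1\rangle$ acting on $E_v$, with respect to the generators $\alpha_1,\beta_1,\gamma_1$; it is identified with a subgraph of $\Sigma_1/\mathcal H_n$: the edge $\{w,\alpha_1(w)\}$ is the $CAB$-edge at $w$, and a non-loop edge $\{w,\beta_1(w)\}$ (resp. $\{w,\gamma_1(w)\}$) is the $B$-edge (resp. $C$-edge) at $w$. $\Sigma_{1,v}$ is a tree, so it lifts to a subtree $\Sigma_{1,v}'$ of $\Sigma_1\subset\mathbb C$. The path $\rho_v'$. Consider the half-integral grid on $\mathbb C$, i.e. the tiling by the translates of the square with vertices $0,\frac12,\frac i2,\frac{1+i}2$ by elements of $\frac12\mathbb Z[i]$, and let $Q_n$ be the graph formed by the sides of this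 grid on the quotient $\mathbb C/\mathcal H_n$. The vertices of $\Sigma_{1,v}$ are centers of the squares of one color of the checkerboard coloring of $\mathbb C/\mathcal H_n$. Since $\Sigma_{1,v}$ is a tree, there is a closed Eulerian path $\rho_v$ in $Q_n$ without transversal self-intersections which goes around $\Sigma_{1,v}$, i.e. does not intersect it transversally. The path $\rho_v'$ is the corresponding lift of $\rho_v$ to $\mathbb C$, i.e. the closed path in the grid going around $\Sigma_{1,v}'$. Paper folding. Consider a strip of paper of length $2^{n-1}$ and denote one of its ends by $C$. For $v=X_1X_2\ldots X_n$ fold the strip in two, fixing $C$ and moving the other end of the strip to $C$ on the left side if $X_n=\mathtt L$, or on the right side if $X_n=\mathtt R$. Repeat the procedure (with the folded strip) for the word $X_1X_2\ldots X_{n-1}$, and so on. After $n$ steps unfold the strip so that all bends are at right angles; this gives a broken line $P_v$. Take a copy of $P_v$, rotate it by $180^\circ$ and connect its endpoints with those of $P_v$; the resulting closed broken line is $\overline P_v$.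
   Formalization: As stated the lengths differ by a factor 2 (ρ_v' has length 2^{n+1}, P̄_v has length 2^n). The formal theorem has P̄_{Lv} in place of P̄_v: a strip of length 2^n is folded along X_n,…,X_1 and then once more to the left. *)

(* Defs.v *)
From mathcomp Require Import all_boot all_order all_algebra.
From mathcomp Require Import complex.
From mathcomp Require Import reals.

Set Implicit Arguments.
Unset Strict Implicit.
Unset Printing Implicit Defensive.

Import Order.TTheory GRing.Theory Num.Theory.
Local Open Scope ring_scope.
Local Open Scope complex_scope.

(** * The tree automorphisms *)

Inductive side := sL | sR.

Definition flip (X : side) : side := if X is sL then sR else sL.

(* The letter X_b of the alphabet (L_0, L_1, R_0, R_1) is (X, b). *)
Definition letter := (side * bool)%type.
Definition word := seq letter.

Inductive gen := al1 | be1 | ga1 | al2 | be2 | ga2.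

(* [true] when the generator acts on the first letter by sigma = (12)(34),
   [false] when it fixes the first letter. *)
Definition active (g : gen) : bool :=
  match g with al1 | al2 => true | _ => false end.

(* [section g x] is the coordinate of g at x, a product of generators written
   from left to right; [::] is the trivial automorphism. *)
Definition section (g : gen) (x : letter) : seq gen :=
  match g, x with
  | al1, (sL, false) => [:: be1]
  | al1, (sL, true)  => [:: be1]
  | al1, (sR, false) => [:: be1; al1]
  | al1, (sR, true)  => [:: al1; be1]
  | be1, (sL, false) => [::]
  | be1, (sL, true)  => [:: be1; al1; be1]
  | be1, (sR, false) => [:: al1]
  | be1, (sR, true)  => [::]
  | ga1, (_, false)  => [:: ga1]
  | ga1, (_, true)   => [:: be1]
  | al2, (sL, false) => [:: be2; al2]
  | al2, (sL, true)  => [:: al2; be2]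
  | al2, (sR, false) => [:: be2]
  | al2, (sR, true)  => [:: be2]
  | be2, (sL, false) => [:: al2]
  | be2, (sL, true)  => [::]
  | be2, (sR, false) => [::]
  | be2, (sR, true)  => [:: be2; al2; be2]
  | ga2, (_, false)  => [:: ga2]
  | ga2, (_, true)   => [:: be2]
  end.

(* g (x u) = sigma_g (x) g_x (u).  The rightmost factor of a product acts
   first, hence [foldr].  The first argument is fuel: the recursive calls are
   on images of u, which have the length of u. *)
Fixpoint act_rec (n : nat) (g : gen) (w : word) : word :=
  match n, w with
  | m.+1, x :: u =>
      (x.1, x.2 (+) active g) :: foldr (act_rec m) u (section g x)
  | _, _ => w
  end.

Definition act (g : gen) (w : word) : word := act_rec (size w) g w.

Definition inE (v : seq side) (w : word) : Prop := map fst w = v.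

Definition base_word (v : seq side) : word := [seq (X, false) | X <- v].

(** * The group H and its two actions *)

Inductive hgen := hA | hB | hC.

(* The elements of H are represented by words in A, B, C; no inverses are
   needed, as A, B and C are involutions. *)
Definition hgen_tree (g : hgen) : seq gen :=
  match g with
  | hA => [:: al2]
  | hB => [:: be1; be2]
  | hC => [:: ga1; ga2]
  end.

Definition hact (h : seq hgen) (w : word) : word :=
  foldr act w (flatten (map hgen_tree h)).

(* The generators of the first Schreier graph, with the name, as an element of
   H, of the edges of Sigma_1 which they draw. *)
Inductive names : gen -> seq hgen -> Prop :=
  | names_al : names al1 [:: hC; hA; hB]
  | names_be : names be1 [:: hB]
  | names_ga : names ga1 [:: hC].

Section Plane.

Variable R : realType.

Local Notation C := (R[i]).

Definition hgen_aff (g : hgen) (z : C) : C :=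
  match g with
  | hA => - z + 1
  | hB => - z + 1 + 'i
  | hC => - z
  end.

(* The right action: z . (g h) = (z . g) . h, hence [foldl]. *)
Definition haff (z : C) (h : seq hgen) : C :=
  foldl (fun y g => hgen_aff g y) z h.

Definition xi : C := (1 + 'i) / 4.

Definition gaussian (q : C) : Prop :=
  complex.Re q \is a Num.int /\ complex.Im q \is a Num.int.

(* f belongs to H_n. *)
Definition inHn (n : nat) (f : C -> C) : Prop :=
  exists (s : bool) (q : C), gaussian q /\
    forall z, f z = (-1) ^+ s * z + (1 + 'i) ^+ n * q.

(* The edge of Sigma_1 named g from z to z'. *)
Definition Sigma1_edge (g : seq hgen) (z z' : C) : Prop :=
  exists h : seq hgen, z = haff xi h /\ z' = haff xi (g ++ h).

(* z is a point of the class xi . h . H_n which represents w = h (w_0). *)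
Definition lies_over (v : seq side) (w : word) (z : C) : Prop :=
  exists h : seq hgen, hact h (base_word v) = w /\
    exists f, inHn (size v) f /\ z = f (haff xi h).

Definition schreier_edge (v : seq side) (g : gen) (w : word) : Prop :=
  [/\ inE v w, exists h, names g h & act g w <> w].

(* A lift of Sigma_{1,v} to Sigma_1, given by the positions in the plane of the
   vertices; each edge {w, g (w)} goes to the edge of Sigma_1 with the name of
   g at the position of w. *)
Definition is_lift (v : seq side) (pos : word -> C) : Prop :=
  (forall w, inE v w -> lies_over v w (pos w)) /\
  (forall w g h, names g h -> schreier_edge v g w ->
     Sigma1_edge h (pos w) (pos (act g w))).

(** * Closed paths in the half-integral grid *)

Definition grid_vertex (z : C) : Prop := gaussian (2 * z).

Definition grid_side (z z' : C) : Prop :=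
  [/\ grid_vertex z, grid_vertex z' & `|z' - z| = 1 / 2].

(* A closed broken line is the list of its vertices, each joined to the next
   one and the last one to the first. *)
Definition vtx (rho : seq C) (j : nat) : C := nth 0 rho (j %% size rho)%N.

Definition det (u w : C) : R :=
  complex.Re u * complex.Im w - complex.Im u * complex.Re w.

(* w is strictly inside the sector swept counterclockwise from the direction
   of u to that of u'; the sector is convex when 0 <= det u u', and otherwise
   its complement is. *)
Definition in_sector (u u' w : C) : bool :=
  if 0 <= det u u' then (0 < det u w) && (0 < det w u')
  else (0 < det u w) || (0 < det w u').

(* The broken lines a - p - b and c - p - d cross at p: c and d are strictly
   on different sides of a - p - b. *)
Definition crosses (p a b c d : C) : bool :=
  in_sector (a - p) (b - p) (c - p) && in_sector (b - p) (a - p) (d - p)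
  || in_sector (a - p) (b - p) (d - p) && in_sector (b - p) (a - p) (c - p).

(* Every side of the grid on the quotient by H_n is traversed exactly once by
   the image of rho. *)
Definition eulerian (n : nat) (rho : seq C) : Prop :=
  (forall j, (j < size rho)%N -> grid_side (vtx rho j) (vtx rho j.+1)) /\
  (forall z z', grid_side z z' ->
     exists! j, (j < size rho)%N /\
       exists f, inHn n f /\
         ((f (vtx rho j) = z /\ f (vtx rho j.+1) = z') \/
          (f (vtx rho j) = z' /\ f (vtx rho j.+1) = z))).

(* Two different passages of rho through one point of the quotient by H_n do
   not cross. *)
Definition no_self_crossing (n : nat) (rho : seq C) : Prop :=
  forall j k f, (j < size rho)%N -> (k < size rho)%N -> j <> k -> inHn n f ->
    f (vtx rho k.+1) = vtx rho j.+1 ->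
    ~~ crosses (vtx rho j.+1) (vtx rho j) (vtx rho j.+2)
               (f (vtx rho k)) (f (vtx rho k.+2)).

Definition on_edge (a b p : C) : Prop :=
  exists t : R, [/\ 0 < t, t < 1 & p = a + t%:C * (b - a)].

(* The image of rho in the quotient by H_n does not cross that of the lifted
   tree.  It is enough to look at the vertices of rho: the edges of Sigma_1 are
   diagonals through corners of the grid, and do not meet the grid elsewhere. *)
Definition no_tree_crossing (v : seq side) (pos : word -> C) (rho : seq C) :
    Prop :=
  forall j w g f, (j < size rho)%N -> schreier_edge v g w ->
    inHn (size v) f ->
    on_edge (f (pos w)) (f (pos (act g w))) (vtx rho j.+1) ->
    ~~ crosses (vtx rho j.+1) (vtx rho j) (vtx rho j.+2)
               (f (pos w)) (f (pos (act g w))).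

Definition corner (c z : C) : Prop := exists k : nat, z = c + 'i ^+ k * xi.

(* Among the closed paths with the same image in the quotient, this selects
   the ones along the given lift of the tree: each side of rho is a side of a
   square of the grid with center at a vertex of the lift. *)
Definition along_lift (v : seq side) (pos : word -> C) (rho : seq C) : Prop :=
  forall j, (j < size rho)%N ->
    exists w, [/\ inE v w, corner (pos w) (vtx rho j)
                & corner (pos w) (vtx rho j.+1)].

Definition goes_around (v : seq side) (pos : word -> C) (rho : seq C) : Prop :=
  [/\ eulerian (size v) rho, no_self_crossing (size v) rho,
      no_tree_crossing v pos rho & along_lift v pos rho].

(** * Paper folding *)

(* The bends of the unfolded strip as turns, in order from the end C, left and
   right being those of someone who walks along the strip from C.  The first
   fold is made by the last letter and gives the middle bend; the later folds
   bend both layers, and the second layer is walked backwards, so its bends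
   come in reverse order and with the opposite direction. *)
Definition bends (v : seq side) : seq side :=
  foldl (fun t X => t ++ X :: rev (map flip t)) [::] v.

Definition turn (X : side) : C := if X is sL then 'i else - 'i.

(* The vertices, after the initial vertex p, of the broken line with sides of
   length |d|, initial direction d and turns t. *)
Fixpoint broken_line (p d : C) (t : seq side) : seq C :=
  if t is X :: t' then p + d :: broken_line (p + d) (turn X * d) t'
  else [:: p + d].

(* The vertices of P_v after its first one, which is 0; a strip of length
   2^(n-1) folded n times has 2^n sides of length 1/2. *)
Definition folded (v : seq side) : seq C := broken_line 0 (1 / 2) (bends v).

(* The rotation by 180 degrees z |-> e - z exchanges the endpoints 0 and e of
   P_v, so P_v is followed from 0 to e, and then its copy from e to 0.

   Pitfall: for n = size v this line has 2^(n+1) sides of length 1/2, but a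
   closed path around a tree with 2^n vertices has 4 * 2^n sides, four around
   each vertex.  The path around the tree of v is obtained with one more fold,
   a last one to the left, i.e. it is [folded_closed (sL :: v)]. *)
Definition folded_closed (v : seq side) : seq C :=
  let half := belast 0 (folded v) in
  half ++ [seq last 0 (folded v) - z | z <- half].

(* Isometric as closed broken lines, without a chosen initial vertex or
   direction. *)
Definition isometric (p q : seq C) : Prop :=
  exists f : C -> C, (forall z w, `|f z - f w| = `|z - w|) /\
    exists k, map f p = rot k q \/ map f p = rot k (rev q).

End Plane.

(* Main.v *)
From HB Require Import structures.
Require Import Defs.
From mathcomp Require Import all_boot all_order all_algebra.
From mathcomp Require Import complex.
From mathcomp Require Import reals.
From mathcomp Require Import zify ring lra.

(** The vertices of the tree are squares of the half-integral grid, and its edges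
    are the half-turns around common corners of two squares.  A path around the
    tree that keeps the squares on its left follows the boundary of a square,
    turning left at each corner, except at the corners of edges of the tree, where
    it turns right and passes to the other square.  The corners of a square are
    the fixed points of C, A, B and CAB, in counterclockwise order; there are no
    edges at A, and the edges at C, B and CAB are those of ga1, be1 and al1.  So
    four steps of the path apply ga1 al1 be1 to the vertex.

    By the recursions that define the automorphisms, ga1 al1 be1 is the binary
    odometer on the indices of the letters ([tau0], [tau1]).  Hence it is
    transitive on E_v, and the path runs through all sides of all squares once.
    The turns at the corners of A and CAB alternate, left and right, and those at
    B and C tell which of be1 and ga1 fix the vertex.  The same recursions show
    that the latter form the sequence of the word without its first letter, with
    an alternating sequence, determined by the first letter, inserted
    ([tour_turn]).  This is how the last fold changes the bends of a strip
    ([bends_cons]), so the turns are those of the line folded according to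
    [sL :: v] ([trnE], [fold_turnE]).  They agree on the nose if the last letter is
    [sL]; if it is [sR], the line has to be followed backwards
    ([closed_turn_rev]).  Paths with the same turns and sides of the same length
    are isometric ([isometry_of_turns]).

    It remains to see that lifts exist, and that a path around a lift is this tour
    up to its initial vertex and direction.  A lift sends each word to an element
    of H, a sign and a Gaussian integer.  Prepending a letter to the words
    amounts to a multiplication by 1 + i or 1 - i, which gives a lift recursively
    ([hl_edge]); modulo H_n it intertwines the two actions of H ([hl_equiv]), and
    therefore it identifies E_v with H / H_n ([hl_inj], [hl_surj]).  So every
    lift is a translate of this one by an element of H_n ([lift_hp]), and its
    squares represent the squares of their color in the quotient.

    For the uniqueness, a pass of the path through a corner cannot be straight,
    since the two other sides at that corner would form a straight pass that
    crosses it.  At a corner of an edge of the tree the path must cross over to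
    the other square, because otherwise it would cross the edge.  At any other
    corner it must stay on its square ([white_absurd]): if it crossed over, the
    path in the tree between the two squares would close up to a cycle that the
    path around the tree never crosses, although it has sides inside and outside
    of it.  The part of the Jordan theorem that this requires is a coloring of the
    complementary squares by the parity of the crossings of a ray with the cycle
    ([coloring]). *)

Set Implicit Arguments.
Unset Strict Implicit.
Unset Printing Implicit Defensive.

Import Order.TTheory GRing.Theory Num.Theory.
Local Open Scope ring_scope.

Local Notation inEv := Defs.inE.

(** * The automata *)

Lemma side_can : cancel (fun X => if X is sL then true else false)
                        (fun b => if b then sL else sR).
Proof. by case. Qed.

HB.instance Definition _ := Equality.copy side (can_type side_can).

Lemma act_rec_sides m g w : map fst (act_rec m g w) = map fst w.
Proof.
elim: m g w => [|m IH] g [|x u] //=; congr cons.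
by elim: (section g x) => //= h s <-; rewrite IH.
Qed.

Lemma act_sides g w : map fst (act g w) = map fst w.
Proof. exact: act_rec_sides. Qed.

Lemma size_act g w : size (act g w) = size w.
Proof. by rewrite -(size_map fst) act_sides size_map. Qed.

Lemma actE g x u :
  act g (x :: u) = (x.1, x.2 (+) active g) :: foldr act u (section g x).
Proof.
rewrite {1}/act /=; congr cons.
suff H s : foldr (act_rec (size u)) u s = foldr act u s /\
           size (foldr act u s) = size u by case: (H (section g x)).
elim: s => //= h s [-> Hs]; rewrite size_act Hs; split=> //.
by rewrite /act Hs.
Qed.

Fact ac_key : unit. Proof. exact: tt. Qed.

(** The action, sealed: otherwise unification unfolds it when it compares an
    image under a generator with a nonempty word. *)
Definition ac := locked_with ac_key act.

Lemma ac_act : ac = act.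
Proof. by rewrite /ac unlock. Qed.

Lemma ac_nil g : ac g [::] = [::].
Proof. by rewrite ac_act. Qed.

Lemma acE g x u :
  ac g (x :: u) = (x.1, x.2 (+) active g) :: foldr ac u (section g x).
Proof. by rewrite ac_act actE. Qed.

Lemma ac_sides g w : map fst (ac g w) = map fst w.
Proof. by rewrite ac_act act_sides. Qed.

Lemma size_ac g w : size (ac g w) = size w.
Proof. by rewrite ac_act size_act. Qed.

Lemma ac_inEv v g w : inEv v w -> inEv v (ac g w).
Proof. by rewrite /Defs.inE ac_sides. Qed.

(** Sections of the generators apply to images of the tail, which only have the
    same length as the tail: the induction hypothesis has to cover all of them. *)
Lemma word_ind (P : word -> Prop) : P [::] ->
  (forall x u, (forall u', size u' = size u -> P u') -> P (x :: u)) ->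
  forall w, P w.
Proof.
move=> P0 PS w; elim: {w}(size w) {-2}w (erefl (size w)) => [|n IH] [|x u] // [Hu].
by apply: PS => u' Hu'; apply: IH; rewrite Hu'.
Qed.

Lemma acK g : involutive (ac g).
Proof.
move=> w; elim/word_ind: w g => [|[X b] u IH] g; first by rewrite !ac_nil.
have K h u' : size u' = size u -> ac h (ac h u') = u' by move/IH; apply.
by case: g X b => [] [] []; rewrite !acE /= ?K ?size_ac ?K ?size_ac ?K.
Qed.

(** At each first letter at least one of the two sections is trivial. *)
Lemma be1_be2C w : ac be1 (ac be2 w) = ac be2 (ac be1 w).
Proof. by case: w => [|[[] []] u]; rewrite ?ac_nil ?[ac be2 (_ :: _)]acE ?[ac be1 (_ :: _)]acE /= ?acE. Qed.

Lemma be2E w : ac be2 w = ac be1 (ac be2 (ac be1 w)).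
Proof. by rewrite -be1_be2C acK. Qed.

Lemma ac_al1_neq (w : word) : w != [::] -> ac al1 w != w.
Proof. by case: w => [|[X b] u] // _; 
rewrite acE eqseq_cons xpair_eqE /=; case: b; rewrite andbF. Qed.

Definition tau w := ac ga1 (ac al1 (ac be1 w)).

(** With [tau1]: the tour around the tree acts on the indices as the binary
    odometer, whose carry restarts the tour on the tail.  This is the source of
    both the connectedness of the tree and the self-similarity of its turns. *)
Lemma tau0 X u : tau ((X, false) :: u) = (X, true) :: u.
Proof.
case: X; rewrite /tau [ac be1 _]acE /= [ac al1 _]acE /= [ac ga1 _]acE /=;
  by rewrite !acK.
Qed.

Lemma tau1 X u : tau ((X, true) :: u) = (X, false) :: tau u.
Proof.
case: X; rewrite /tau [ac be1 _]acE /= [ac al1 _]acE /= [ac ga1 _]acE /=;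
  by rewrite ?acK.
Qed.

(** The orbit of the base word under the odometer, in closed form. *)
Fixpoint odo (v : seq side) (m : nat) : word :=
  if v is X :: v' then (X, odd m) :: odo v' m./2 else [::].

Lemma odo0 v : odo v 0 = base_word v.
Proof. by elim: v => //= X v ->. Qed.

Lemma tau_odo v m : tau (odo v m) = odo v m.+1.
Proof.
elim: v m => [|X v IH] m /=; first by rewrite /tau !ac_nil.
rewrite uphalf_half.
by case: (odd m); rewrite ?tau0 ?tau1 /= ?IH.
Qed.

Lemma odo_inEv v m : inEv v (odo v m).
Proof. by elim: v m => [|X v IH] m //; rewrite /Defs.inE /= IH. Qed.

Lemma odo_period v m : odo v (m + 2 ^ size v) = odo v m.
Proof.
elim: v m => [|X v IH] m //=.
by rewrite expnS mul2n oddD odd_double addbF halfD odd_double andbF add0n doubleK IH.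
Qed.

Lemma odo_inj v m m' : (m < 2 ^ size v)%N -> (m' < 2 ^ size v)%N ->
  odo v m = odo v m' -> m = m'.
Proof.
elim: v m m' => [|X v IH] m m' /=; first by rewrite expn0; case: m; case: m'.
rewrite expnS => lm lm' [eo /IH eh]; rewrite -(odd_double_half m) eo eh ?odd_double_half //.
all: by rewrite ltn_half_double -mul2n.
Qed.

Lemma odo_surj v w : inEv v w -> exists2 m, (m < 2 ^ size v)%N & odo v m = w.
Proof.
elim: v w => [|X v IH] [|[Y b] w] //; first by exists 0%N.
case=> -> /IH [m lm <-]; exists (b + m.*2)%N.
  by rewrite /= expnS mul2n; case: b; rewrite ?ltn_double ?ltn_Sdouble.
by rewrite /= oddD odd_double addbF oddb half_bit_double.
Qed.

Lemma base_inEv v : inEv v (base_word v).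
Proof. by rewrite -odo0; apply: odo_inEv. Qed.

(** * The group of the tiling, in integer coordinates *)

Definition point := (int * int)%type.

(** The map z |-> z + (x + iy), or z |-> - z + (x + iy) when the sign is [true]. *)
Definition aff := (bool * point)%type.

Definition sgn (s : bool) (x : int) : int := if s then - x else x.

Definition mul (a f : aff) : aff :=
  (a.1 (+) f.1, (sgn f.1 a.2.1 + f.2.1, sgn f.1 a.2.2 + f.2.2)).

Definition one : aff := (false, (0, 0)).

(** Twice the corners of the square with center xi, counterclockwise.  They are
    the fixed points of C, A, B and CAB, in this order. *)
Fixpoint kap (k : nat) : point :=
  match k with
  | 0 => (0, 0) | 1 => (1, 0) | 2 => (1, 1) | 3 => (0, 1) | k'.+4 => kap k'
  end.

(** Left multiplication by the half-turn around the corner k. *)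
Definition rotk (k : nat) (a : aff) : aff :=
  (~~ a.1, (a.2.1 + sgn a.1 (kap k).1, a.2.2 + sgn a.1 (kap k).2)).

(** Divisibility of x + iy by the n-th power of 1 + i. *)
Fixpoint dv (n : nat) (x y : int) : Prop :=
  if n is n'.+1 then exists p q, [/\ x = p - q, y = p + q & dv n' p q] else True.

Definition Hn (n : nat) (f : aff) : Prop := dv n f.2.1 f.2.2.

(** Equality of left cosets of H_n: the quotient of b by a, on the left, is in H_n. *)
Definition eqm (n : nat) (a b : aff) : Prop :=
  dv n (b.2.1 - sgn (a.1 (+) b.1) a.2.1) (b.2.2 - sgn (a.1 (+) b.1) a.2.2).

(** Conjugation by the multiplication by 1 + i or 1 - i. *)
Definition phi (X : side) (a : aff) : aff :=
  if X is sL then (a.1, (a.2.1 - a.2.2, a.2.1 + a.2.2))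
  else (a.1, (a.2.1 + a.2.2, a.2.2 - a.2.1)).

Arguments mul : simpl never.
Arguments rotk : simpl never.
Arguments phi : simpl never.

Ltac aff_cases :=
  repeat match goal with
  | a : aff |- _ => destruct a as [? [? ?]]
  | X : side |- _ => destruct X
  end;
  rewrite /mul /rotk /phi /one /sgn /=;
  repeat match goal with s : bool |- _ => destruct s end => /=.

Ltac aff_eq := intros; aff_cases; congr (_, (_, _)); lia.

Lemma mul1 a : mul a one = a.
Proof. aff_eq. Qed.

Lemma one_mul a : mul one a = a.
Proof. aff_eq. Qed.

Lemma mul_rot k a f : mul (rotk k a) f = rotk k (mul a f).
Proof. rewrite /rotk; case: (kap k) => ? ?; aff_eq. Qed.

Lemma rotkK k : involutive (rotk k).
Proof. move=> a; rewrite /rotk; case: (kap k) => ? ?; aff_eq. Qed.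

Lemma dvD n x y x' y' : dv n x y -> dv n x' y' -> dv n (x + x') (y + y').
Proof.
elim: n x y x' y' => //= n IH x y x' y' [p [q [-> -> H]]] [p' [q' [-> -> H']]].
by exists (p + p'), (q + q'); split; [lia|lia|apply: IH].
Qed.

Lemma dvN n x y : dv n x y -> dv n (- x) (- y).
Proof.
elim: n x y => //= n IH x y [p [q [-> -> H]]].
by exists (- p), (- q); split; [lia|lia|apply: IH].
Qed.

Lemma dvi n x y : dv n x y -> dv n y (- x).
Proof.
elim: n x y => //= n IH x y [p [q [-> -> H]]].
by exists q, (- p); split; [lia|lia|apply: IH].
Qed.

Lemma dvi' n x y : dv n x y -> dv n (- y) x.
Proof. by move/dvi/dvi/dvi; rewrite opprK. Qed.

Lemma dv0 n : dv n 0 0.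
Proof. by elim: n => //= n IH; exists 0, 0. Qed.

Lemma dv_sgn n s x y : dv n x y -> dv n (sgn s x) (sgn s y).
Proof. by case: s => //; apply: dvN. Qed.

Lemma dv_eq n x y x' y' : dv n x y -> x' = x -> y' = y -> dv n x' y'.
Proof. by move=> H -> ->. Qed.

Lemma eqm_refl n a : eqm n a a.
Proof. by rewrite /eqm addbb /= !subrr; apply: dv0. Qed.

Lemma eqm_sym n a b : eqm n a b -> eqm n b a.
Proof.
by move/(dv_sgn (~~ (a.1 (+) b.1)))/dv_eq; apply; aff_cases; lia.
Qed.

Lemma eqm_trans n a b c : eqm n a b -> eqm n b c -> eqm n a c.
Proof.
move=> /(dv_sgn (b.1 (+) c.1)) H1 H2.
by apply: (dv_eq (dvD H1 H2)); aff_cases; lia.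
Qed.

Lemma eqm_rot n k a b : eqm n a b -> eqm n (rotk k a) (rotk k b).
Proof.
by rewrite /rotk; case: (kap k) => ? ?; move/dv_eq; apply; aff_cases; lia.
Qed.

(** As 1 + i and 1 - i are associates, both conjugations map H_n onto H_(n+1). *)
Lemma eqm_phi n X a b : eqm n a b -> eqm n.+1 (phi X a) (phi X b).
Proof.
rewrite /eqm => H /=; case: X => /=.
  by eexists; eexists; split; last exact: H; aff_cases; lia.
by eexists; eexists; split; last exact: dvi H; aff_cases; lia.
Qed.

Lemma phi_eqm n X a b : eqm n.+1 (phi X a) (phi X b) -> eqm n a b.
Proof.
rewrite /eqm /= => -[p [q [e1 e2 H]]]; case: X e1 e2 => /= e1 e2.
  by apply: (dv_eq H); revert e1 e2; aff_cases; lia.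
by apply: (dv_eq (dvi' H)); revert e1 e2; aff_cases; lia.
Qed.

Lemma eqm_mul n a f : eqm n a (mul a f) <-> Hn n f.
Proof. by split => /dv_eq; apply; aff_cases; lia. Qed.

Lemma HnM n f g : Hn n f -> Hn n g -> Hn n (mul f g).
Proof. by move=> /(dv_sgn g.1) Hf Hg; apply: dvD. Qed.

Lemma eqm_ex n a b : eqm n a b -> exists2 f, Hn n f & b = mul a f.
Proof.
move=> H; exists (a.1 (+) b.1, (b.2.1 - sgn (a.1 (+) b.1) a.2.1,
                               b.2.2 - sgn (a.1 (+) b.1) a.2.2)) => //.
by clear H; aff_eq.
Qed.

Lemma mul_fix a f : mul a f = a -> f = one.
Proof. by aff_cases => -[] *; congr (_, (_, _)); lia. Qed.

(** * The canonical lift of the tree *)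

(** The word [(X, true) :: u] is the image under [al1] of
    [(X, false) :: mate X u]. *)
Definition mate (X : side) (u : word) : word :=
  if X is sL then ac be1 u else ac al1 (ac be1 u).

Lemma size_mate X u : size (mate X u) = size u.
Proof. by case: X; rewrite /= !size_ac. Qed.

Lemma mate_inEv v X u : inEv v u -> inEv v (mate X u).
Proof. by case: X => /= H; do !apply: ac_inEv. Qed.

(** The square of the canonical lift at a word.  Prepending a letter enlarges the
    tree by the factor 1 + i or 1 - i: the old vertices become the words with
    index 0, and each of them carries an al1-edge to one new vertex, of index 1. *)
Fixpoint hl_rec (m : nat) (w : word) : aff :=
  match m, w with
  | m'.+1, (X, false) :: u => phi X (hl_rec m' u)
  | m'.+1, (X, true) :: u => rotk 3 (phi X (hl_rec m' (mate X u)))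
  | _, _ => one
  end.

Definition hl (w : word) : aff := hl_rec (size w) w.

Lemma hlE X b u : hl ((X, b) :: u) =
  if b then rotk 3 (phi X (hl (mate X u))) else phi X (hl u).
Proof. by case: b => //; rewrite {2}/hl size_mate. Qed.

Lemma hl_base v : hl (base_word v) = one.
Proof. by elim: v => //= X v IH; rewrite hlE IH; case: X. Qed.

Lemma hl_al1 w : w != [::] -> hl (ac al1 w) = rotk 3 (hl w).
Proof.
by case: w => [|[[] []] u] // _; rewrite acE /= ?hlE /= ?rotkK // !acK.
Qed.

(** The identities left to [aff_eq] say that [phi] maps the half-turns of the
    edges of the old tree to the products of half-turns along the paths that
    replace these edges. *)
Lemma hl_edge w :
  (ac be1 w != w -> hl (ac be1 w) = rotk 2 (hl w)) /\
  (ac ga1 w != w -> hl (ac ga1 w) = rotk 0 (hl w)).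
Proof.
elim/word_ind: w => [|[X b] u IH]; first by rewrite !ac_nil eqxx.
have al u' : size u' = size u -> u != [::] ->
    hl (ac al1 u') = rotk 3 (hl u').
  by move=> e nu; apply: hl_al1; rewrite -size_eq0 e size_eq0.
have [IHb IHg] := IH u erefl.
have nil g : ac g u != u -> u != [::] by apply: contraNN => /eqP ->; rewrite ac_nil.
split; rewrite acE; case: X b => [] [] /=; rewrite ?eqxx // eqseq_cons eqxx /= => nu.
- have n0 : u != [::] by case: u nu {IH al IHb IHg nil} => //; rewrite !ac_nil.
  rewrite !hlE /= acK al ?size_ac //; move: (hl _) => a; aff_eq.
- rewrite !hlE al //; last exact: nil nu.
  by move: (hl _) => a; aff_eq.
- by rewrite !hlE /= acK IHb //; move: (hl _) => a; aff_eq.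
- by rewrite !hlE IHg //; move: (hl _) => a; aff_eq.
- rewrite !hlE /= acK !al ?size_ac ?IHb //; try exact: nil nu.
  by move: (hl _) => a; aff_eq.
- by rewrite !hlE IHg //; move: (hl _) => a; aff_eq.
Qed.

Lemma ac_C X b u : ac ga1 (ac ga2 ((X, b) :: u)) =
  (X, b) :: if b then ac be1 (ac be2 u) else ac ga1 (ac ga2 u).
Proof. by case: X b => [] []; rewrite [ac ga2 _]acE /= [ac ga1 _]acE. Qed.

Lemma ac_A X b u : ac al2 ((X, b) :: u) =
  (X, ~~ b) :: if X is sL then
                 if b then ac al2 (ac be2 u) else ac be2 (ac al2 u)
               else ac be2 u.
Proof. by case: X b => [] []; rewrite [ac al2 _]acE. Qed.

Lemma ac_B X b u : ac be1 (ac be2 ((X, b) :: u)) =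
  (X, b) :: match X, b with
            | sL, false => ac al2 u
            | sL, true => ac be1 (ac al1 (ac be1 u))
            | sR, false => ac al1 u
            | sR, true => ac be2 (ac al2 (ac be2 u))
            end.
Proof. by case: X b => [] []; rewrite [ac be2 _]acE /= [ac be1 _]acE. Qed.

(** Modulo H_n, the lift intertwines the action on words with the left
    multiplication: this identifies E_v with H / H_n. *)
Lemma hl_equiv w :
  [/\ eqm (size w) (hl (ac ga1 (ac ga2 w))) (rotk 0 (hl w)),
      eqm (size w) (hl (ac al2 w)) (rotk 1 (hl w)) &
      eqm (size w) (hl (ac be1 (ac be2 w))) (rotk 2 (hl w))].
Proof.
elim/word_ind: w => [|[X b] u IH]; first by split.
set n := size u; have T a b' c := @eqm_trans n a b' c.
have HC u' a : size u' = n -> eqm n (hl u') a ->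
    eqm n (hl (ac ga1 (ac ga2 u'))) (rotk 0 a).
  move=> su' e; have [+ _ _] := IH u' su'; rewrite su' => H.
  exact: T H (eqm_rot 0 e).
have HA u' a : size u' = n -> eqm n (hl u') a ->
    eqm n (hl (ac al2 u')) (rotk 1 a).
  move=> su' e; have [_ + _] := IH u' su'; rewrite su' => H.
  exact: T H (eqm_rot 1 e).
have HB u' a : size u' = n -> eqm n (hl u') a ->
    eqm n (hl (ac be1 (ac be2 u'))) (rotk 2 a).
  move=> su' e; have [_ _ +] := IH u' su'; rewrite su' => H.
  exact: T H (eqm_rot 2 e).
have Hal u' a : size u' = n -> eqm n (hl u') a ->
    eqm n (hl (ac al1 u')) (rotk 3 a).
  move=> su' e; case: (u' =P [::]) => [u0|/eqP/hl_al1 ->]; last exact: eqm_rot.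
  by have -> : n = 0%N by rewrite -su' u0.
have Hb2 a : eqm n (hl (ac be1 u)) a -> eqm n (hl (ac be2 u)) (rotk 2 a).
  by rewrite be2E; apply: HB; rewrite size_ac.
have Hb1 : eqm n (hl (ac be1 u))
    (if X is sL then hl (mate X u) else rotk 3 (hl (mate X u))).
  case: X; first exact: eqm_refl.
  by rewrite -{1}(acK al1 (ac be1 u)); apply: Hal; rewrite ?size_ac //; apply: eqm_refl.
(* A representative modulo H_n of the left-hand side is carried along the
   path of sections; the identity that remains holds in H. *)
have fin k Y a a' w : eqm n (hl w) a -> rotk k (phi Y a) = a' ->
    eqm n.+1 (rotk k (phi Y (hl w))) a'.
  by move=> e <-; apply/eqm_rot/eqm_phi.
have fin0 Y a a' w : eqm n (hl w) a -> phi Y a = a' -> eqm n.+1 (phi Y (hl w)) a'.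
  by move=> e <-; apply: eqm_phi.
split; rewrite ?ac_A ?ac_B ?ac_C; case: X b Hb1 => [] [] /= Hb1;
  rewrite ?hlE /= ?acK; 
  match goal with |- eqm _ (rotk _ _) _ => apply: fin | _ => apply: fin0 end;
  cycle 1.
all: try match goal with |- _ = _ => shelve end.
all: repeat match goal with
  | |- eqm _ (hl (ac al1 _)) _ => apply: Hal; first by rewrite ?size_ac
  | |- eqm _ (hl (ac al2 _)) _ => apply: HA; first by rewrite ?size_ac
  | |- eqm _ (hl (ac be1 (ac be2 _))) _ => apply: HB; first by rewrite ?size_ac
  | |- eqm _ (hl (ac ga1 (ac ga2 _))) _ => apply: HC; first by rewrite ?size_ac
  | |- eqm _ (hl (ac be2 _)) _ => apply: Hb2
  | |- eqm _ (hl (ac be1 _)) _ => exact: Hb1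
  | |- eqm _ (hl _) _ => exact: eqm_refl
  end.
Unshelve.
all: move: (hl _) => a; aff_eq.
Qed.

(** For x + iy, divisibility by 1 + i.  The images of [phi] have it and their
    half-turns around the corner 3 do not, so it reads the first index of a word
    off its coset. *)
Definition par (a : aff) : bool := (2 %| a.2.1 + a.2.2)%Z.

Lemma par_phi X a : par (phi X a).
Proof. by rewrite /par; aff_cases; lia. Qed.

Lemma par_rot3 a : par (rotk 3 a) = ~~ par a.
Proof. by rewrite /par; aff_cases; lia. Qed.

Lemma par_eqm n a b : eqm n.+1 a b -> par a = par b.
Proof.
by rewrite /eqm /par => -[p [q [e1 e2 _]]]; revert e1 e2; aff_cases; lia.
Qed.

Lemma par_phi_ex X a : par a -> exists b, a = phi X b.
Proof.
case: a => s [x y]; rewrite /par /= => e; case: X.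
  by exists (s, (((x + y) %/ 2)%Z, ((y - x) %/ 2)%Z)); rewrite /phi /=; congr (_, (_, _)); lia.
by exists (s, (((x - y) %/ 2)%Z, ((x + y) %/ 2)%Z)); rewrite /phi /=; congr (_, (_, _)); lia.
Qed.

Lemma mate_inj X : injective (mate X).
Proof.
have I g : injective (ac g) := can_inj (acK g).
by case: X => u u' /=; [move/I | move/I/I].
Qed.

Lemma hl_inj v w w' : inEv v w -> inEv v w' ->
  eqm (size v) (hl w) (hl w') -> w = w'.
Proof.
elim: v w w' => [|X v IH] [|[Y b] w] [|[Z b'] w'] //=; rewrite /Defs.inE /=.
move=> [-> Hw] [-> Hw'] e; have := par_eqm e.
case: b b' e => [] []; rewrite ?hlE ?par_rot3 ?par_phi // => e _.
  move/(eqm_rot 3): e; rewrite !rotkK => /phi_eqm/IH.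
  by move=> H; congr cons; apply: (@mate_inj X); apply: H; apply: mate_inEv.
by move/phi_eqm/IH: e => ->.
Qed.

Lemma hl_surj v a : exists2 w, inEv v w & eqm (size v) (hl w) a.
Proof.
elim: v a => [|X v IH] a; first by exists [::].
case: (boolP (par a)) => pa.
  have [b ->] := par_phi_ex X pa; have [w Hw e] := IH b.
  by exists ((X, false) :: w); [rewrite /Defs.inE /= Hw | rewrite hlE; apply: eqm_phi].
have /(par_phi_ex X) [b eb] : par (rotk 3 a) by rewrite par_rot3.
have [w Hw e] := IH b.
exists (ac al1 ((X, false) :: w)); first by apply: ac_inEv; rewrite /Defs.inE /= Hw.
by rewrite hl_al1 // hlE -(rotkK 3 a) eb; apply/eqm_rot/eqm_phi.
Qed.

(** * Words in A, B, C *)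

Definition hidx (g : hgen) : nat :=
  match g with hC => 0 | hA => 1 | hB => 2 end.

Definition aff_of (h : seq hgen) : aff := foldr (fun g => rotk (hidx g)) one h.

Lemma hact_cons g h w :
  hact (g :: h) w = foldr ac (hact h w) (hgen_tree g).
Proof. by rewrite ac_act /hact /= foldr_cat. Qed.

Lemma hact_sides h w : map fst (hact h w) = map fst w.
Proof.
by elim: h w => // g h IH w; rewrite hact_cons; case: g; rewrite /= !ac_sides IH.
Qed.

Lemma hl_hact h w : eqm (size w) (hl (hact h w)) (mul (aff_of h) (hl w)).
Proof.
elim: h w => [|g h IH] w.
  by rewrite one_mul; apply: eqm_refl.
rewrite hact_cons /= mul_rot; apply: eqm_trans (eqm_rot _ (IH w)).
have <- : size (hact h w) = size w by rewrite -(size_map fst) hact_sides size_map.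
by have [] := hl_equiv (hact h w); case: g.
Qed.

(** Half-turns around two corners compose to a translation along the side or the
    diagonal between them. *)
Lemma aff_of_surj a : exists h, aff_of h = a.
Proof.
have T (k : nat) (g : hgen) (d e : int) : hidx g = k -> kap k = (d, e) ->
    forall h (m : nat), exists h', aff_of h' =
    ((aff_of h).1, ((aff_of h).2.1 + m%:Z * d, (aff_of h).2.2 + m%:Z * e)).
  move=> eg ek h; elim=> [|m [h' IH]].
    by exists h; case: (aff_of h) => s [x y] /=; congr (_, (_, _)); lia.
  exists (if (aff_of h).1 then [:: g, hC & h'] else [:: hC, g & h']).
  by case: ifP => es; rewrite /= eg IH /rotk ek es /sgn /=; congr (_, (_, _)); lia.
have N (k : nat) (g : hgen) (d e : int) : hidx g = k -> kap k = (d, e) ->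
    forall h (m : nat), exists h', aff_of h' =
    ((aff_of h).1, ((aff_of h).2.1 - m%:Z * d, (aff_of h).2.2 - m%:Z * e)).
  move=> eg ek h; elim=> [|m [h' IH]].
    by exists h; case: (aff_of h) => s [x y] /=; congr (_, (_, _)); lia.
  exists (if (aff_of h).1 then [:: hC, g & h'] else [:: g, hC & h']).
  by case: ifP => es; rewrite /= eg IH /rotk ek es /sgn /=; congr (_, (_, _)); lia.
have TZ (k : nat) (g : hgen) (d e : int) : hidx g = k -> kap k = (d, e) ->
    forall h (m : int), exists h', aff_of h' =
    ((aff_of h).1, ((aff_of h).2.1 + m * d, (aff_of h).2.2 + m * e)).
  move=> eg ek h [m|m]; first exact: T eg ek h m.
  by have [h' e'] := N _ _ _ _ eg ek h m.+1; exists h'; rewrite e'; congr (_, (_, _)); lia.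
case: a => s [x y].
pose h0 := if s then [:: hC] else [::].
have [h1 e1] := TZ 1%N hA 1 0 erefl erefl h0 (x - y).
have [h2 e2] := TZ 2 hB 1 1 erefl erefl h1 y.
exists h2; rewrite e2 e1 /h0; case: s {h0 h1 h2 e1 e2} => /=; rewrite /rotk /=; congr (_, (_, _)); lia.
Qed.

(** * The plane *)

Local Open Scope complex_scope.

Section Plane.

Variable R : realType.
Local Notation C := R[i].

Lemma complexP (z w : C) :
  complex.Re z = complex.Re w -> complex.Im z = complex.Im w -> z = w.
Proof. by case: z w => a b [c d] /= -> ->. Qed.

Lemma complexi : ('i)%R = (0 +i* 1 : C).
Proof. by []. Qed.

Lemma natcE n : n%:R = (n%:R +i* 0 : C).
Proof. by rewrite -(rmorph_nat (real_complex R)). Qed.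

Lemma divnatcE (a b : R) n : (a +i* b) / n%:R = ((a / n%:R) +i* (b / n%:R) : C).
Proof.
rewrite natcE; simpc; rewrite expr0n addr0.
case: (n =P 0%N) => [->|/eqP n0]; first by rewrite invr0 !(mulr0, mul0r).
have nz : n%:R != 0 :> R by rewrite pnatr_eq0.
by apply: complexP => /=; field.
Qed.

Definition rsgn (s : bool) (x : R) : R := if s then - x else x.

Definition ev (a : aff) (z : C) : C :=
  (rsgn a.1 (complex.Re z) + a.2.1%:~R) +i* (rsgn a.1 (complex.Im z) + a.2.2%:~R).

Lemma signcE (s : bool) (x y : R) :
  (-1) ^+ s * (x +i* y) = rsgn s x +i* rsgn s y.
Proof. by case: s; rewrite ?expr0 ?expr1 ?mul1r ?mulN1r. Qed.

Lemma rsgn_int s (x : int) : rsgn s x%:~R = (sgn s x)%:~R.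
Proof. by case: s; rewrite //= mulrNz. Qed.

Lemma rsgnD s x y : rsgn s (x + y) = rsgn s x + rsgn s y.
Proof. by case: s; rewrite //= opprD. Qed.

Lemma rsgn_add s s' x : rsgn s (rsgn s' x) = rsgn (s' (+) s) x.
Proof. by case: s s' => [] []; rewrite //= opprK. Qed.

Lemma ev_mul a f z : ev (mul a f) z = ev f (ev a z).
Proof.
by case: z => x y; rewrite /ev /mul /= !rsgnD !rsgn_add !rsgn_int !intrD !addrA.
Qed.

Lemma ev_one z : ev one z = z.
Proof. by case: z => x y; rewrite /ev /= !addr0. Qed.

Lemma hgen_affE g z : hgen_aff g z = ev (rotk (hidx g) one) z.
Proof.
by case: z => x y; case: g; rewrite /ev /hgen_aff /rotk ?complexi /=; simpc;
  rewrite ?addr0 //= ?add0r.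
Qed.

Lemma haffE z h : haff z h = ev (aff_of h) z.
Proof.
elim: h z => [|g h IH] z; first by rewrite /= ev_one.
rewrite /= IH hgen_affE -ev_mul mul_rot; congr ev; rewrite /=.
by congr rotk; move: (aff_of h) => a; aff_eq.
Qed.

Lemma xiE : xi R = (1 / 4) +i* (1 / 4).
Proof.
rewrite /xi complexi (_ : 1 + _ = 1 +i* 1); first by rewrite divnatcE.
by apply: complexP; rewrite /= ?addr0 ?add0r.
Qed.

Lemma ev_xi a : ev a (xi R) = ((sgn a.1 1 + 4 * a.2.1)%:~R / 4)
                          +i* ((sgn a.1 1 + 4 * a.2.2)%:~R / 4).
Proof.
by rewrite xiE /ev /=; case: a => [[] [x y]] /=; apply: complexP => /=;
  rewrite intrD intrM ?mulrNz; lra.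
Qed.

Lemma intr_eq (x y : int) : (x%:~R = y%:~R :> R) -> x = y.
Proof. exact: intr_inj. Qed.

(** The point xi has trivial stabilizer: the squares are labelled by the group. *)
Lemma ev_inj a b : ev a (xi R) = ev b (xi R) -> a = b.
Proof.
rewrite !ev_xi => -[/(mulIf _) e1 /(mulIf _) e2].
have nz : (4 : R)^-1 != 0 by rewrite invr_eq0 pnatr_eq0.
move: (intr_eq (e1 nz)) (intr_eq (e2 nz)).
by clear; case: a b => [[] [x y]] [[] [x' y']] /=; intros; congr (_, (_, _)); lia.
Qed.

Lemma gaussianP (q : C) : gaussian q <-> exists x y : int, q = x%:~R +i* y%:~R.
Proof.
split=> [[/intrP [x ex] /intrP [y ey]]|[x [y ->]]]; last by split; apply: rpred_int.
by exists x, y; apply: complexP.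
Qed.

Lemma dvP n x y : dv n x y <-> exists p q : int,
  (x%:~R +i* y%:~R : C) = (1 + ('i)%R) ^+ n * (p%:~R +i* q%:~R).
Proof.
have e1 : 1 + 'i = (1 +i* 1 : C).
  by rewrite complexi; apply: complexP; rewrite /= ?addr0 ?add0r.
elim: n x y => [|n IH] x y /=.
  by split=> // _; exists x, y; rewrite expr0 mul1r.
have st (p q : int) : ((p - q)%:~R +i* (p + q)%:~R : C) = (1 + ('i)%R) * (p%:~R +i* q%:~R).
  by rewrite e1; apply: complexP; rewrite /= ?intrB ?intrD !mul1r // addrC.
split=> [[p [q [-> -> /IH [p' [q' e]]]]]|[p [q e]]].
  by exists p', q'; rewrite st e exprS mulrA.
have [p' [q' e']] : exists p' q' : int,
    (p'%:~R +i* q'%:~R : C) = (1 + ('i)%R) ^+ n * (p%:~R +i* q%:~R).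
  elim: {IH e} n => [|n [p' [q' IH]]]; first by exists p, q; rewrite expr0 mul1r.
  by exists (p' - q'), (p' + q'); rewrite st IH exprS mulrA.
exists p', q'; move: e; rewrite exprS -mulrA -e' -st => -[/intr_eq -> /intr_eq ->].
by split=> //; apply/IH; exists p, q.
Qed.

Lemma inHnP n f : inHn n f <-> exists2 a, Hn n a & forall z : C, f z = ev a z.
Proof.
have evE a z : ev a z = (-1) ^+ a.1 * z + (a.2.1%:~R +i* a.2.2%:~R).
  by case: z => x y; rewrite signcE.
split=> [[s [_ [/gaussianP [x [y ->]] H]]]|[a /dvP [p [q e]] H]].
  have [p [q e]] : exists p q : int,
      (p%:~R +i* q%:~R : C) = (1 + ('i)%R) ^+ n * (x%:~R +i* y%:~R).
    elim: n {H} => [|n [p [q IH]]]; first by exists x, y; rewrite expr0 mul1r.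
    exists (p - q), (p + q); rewrite exprS -mulrA -IH complexi.
    by apply: complexP; rewrite /= ?intrB ?intrD !addr0 !add0r !mul1r // addrC.
  exists (s, (p, q)); first by apply/dvP; exists x, y.
  by move=> z; rewrite H evE e.
exists a.1, (p%:~R +i* q%:~R); split; first by apply/gaussianP; exists p, q.
by move=> z; rewrite H evE e.
Qed.
End Plane.

(** * Lifts of the tree *)

(** The generator that labels the corner k of the squares; no edge of the tree
    passes through the corners of the class of A. *)
Fixpoint gk (k : nat) : word -> word :=
  match k with
  | 0 => ac ga1 | 1 => id | 2 => ac be1 | 3 => ac al1 | k'.+4 => gk k'
  end.

Lemma four_ind (P : nat -> Prop) : P 0%N -> P 1%N -> P 2%N -> P 3%N ->
  (forall k, P k -> P k.+4) -> forall k, P k.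
Proof.
move=> P0 P1 P2 P3 PS k; suff [] : [/\ P k, P k.+1, P k.+2 & P k.+3] by [].
by elim: k => [|k [? ? ? ?]]; split=> //; apply: PS.
Qed.

Lemma gkK k : involutive (gk k).
Proof. by elim/four_ind: k => //= *; apply: acK. Qed.

Lemma gk_inEv v k w : inEv v w -> inEv v (gk k w).
Proof. by elim/four_ind: k => //= *; apply: ac_inEv. Qed.

(** One step of the odometer is a product of three generators, each of which
    either moves along an edge or fixes its argument. *)
Lemma conn_ind v (P : word -> Prop) : P (base_word v) ->
  (forall w k, inEv v w -> gk k w != w -> P w -> P (gk k w)) ->
  forall w, inEv v w -> P w.
Proof.
move=> P0 PS w /odo_surj [m _ <-]; elim: m => [|m IH]; first by rewrite odo0.
have st k w' : inEv v w' -> P w' -> P (gk k w').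
  by move=> Hw Pw; case: (gk k w' =P w') => [->|/eqP ne] //; apply: PS.
rewrite -tau_odo; have I := odo_inEv v m.
by apply: (st 0%N); [|apply: (st 3%N); [|apply: (st 2%N)]] => //; do !apply: ac_inEv.
Qed.

(** The lifts are the translates of the canonical one by elements kf of H_n. *)
Definition hp (kf : aff) (w : word) : aff := mul (hl w) kf.

Lemma hp_edge kf k w : gk k w != w -> hp kf (gk k w) = rotk k (hp kf w).
Proof.
rewrite /hp -mul_rot => ne; congr mul; have [eb eg] := hl_edge w.
elim/four_ind: k ne => [||||k] //=; first by rewrite eqxx.
by move=> ne; apply: hl_al1; apply: contraNneq ne => ->; rewrite ac_nil.
Qed.

Section Hp.

Variables (v : seq side) (kf : aff).
Hypothesis Hkf : Hn (size v) kf.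

Lemma eqm_hp w : eqm (size v) (hl w) (hp kf w).
Proof. exact/eqm_mul. Qed.

Lemma hp_inj w w' f f' : inEv v w -> inEv v w' ->
  Hn (size v) f -> Hn (size v) f' ->
  mul (hp kf w) f = mul (hp kf w') f' -> w = w'.
Proof.
move=> Hw Hw' Hf Hf' e; apply: hl_inj Hw Hw' _; apply: eqm_trans (eqm_hp w) _.
apply: eqm_trans (eqm_sym (eqm_hp w')).
apply: (@eqm_trans _ _ (mul (hp kf w) f)); first exact/eqm_mul.
by rewrite e; apply/eqm_sym/eqm_mul.
Qed.

Lemma hp_inj1 w w' : inEv v w -> inEv v w' -> hp kf w' = hp kf w -> w = w'.
Proof.
by move=> Hw Hw' e; apply: (hp_inj Hw Hw' (dv0 _) (dv0 _) (f := one) (f' := one)); rewrite !mul1.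
Qed.

Lemma hp_surj a : exists w f, [/\ inEv v w, Hn (size v) f & a = mul (hp kf w) f].
Proof.
have [w Hw e] := hl_surj v a.
have [f Hf ea] := eqm_ex (eqm_trans (eqm_sym (eqm_hp w)) e).
by exists w, f.
Qed.

End Hp.

Lemma names_gk g h : names g h -> exists k, [/\ (k < 4)%N, act g = gk k &
  forall h', aff_of (h ++ h') = rotk k (aff_of h')].
Proof.
case; [exists 3%N | exists 2%N | exists 0%N]; split=> //=; rewrite ?ac_act // => h'.
by move: (aff_of h') => a; aff_eq.
Qed.

Lemma gk_names k w : gk k w != w -> exists g h, names g h /\ act g = gk k.
Proof.
rewrite -ac_act; elim/four_ind: k => [||||k] //=; rewrite ?eqxx // => _; rewrite ac_act.
- by exists ga1, [:: hC]; split=> //; constructor.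
- by exists be1, [:: hB]; split=> //; constructor.
- by exists al1, [:: hC; hA; hB]; split=> //; constructor.
Qed.

Section LiftPlane.

Variable R : realType.

(** The element of H at w is also the value of a word in A, B, C; that word moves
    the base word to w because words are determined by their cosets. *)
Lemma is_lift_hl v : is_lift v (fun w => ev (hl w) (xi R)).
Proof.
split=> [w Hw|w g h n [Hw _ ne]].
  have [h e] := aff_of_surj (hl w).
  exists h; split; last first.
    by exists id; split; [apply/inHnP; exists one; [apply: dv0|move=> z; rewrite ev_one]
                         | rewrite haffE e].
  have hb : inEv v (hact h (base_word v)) by rewrite /Defs.inE hact_sides; apply: base_inEv.
  have s : size (base_word v) = size v by rewrite size_map.
  apply: hl_inj hb Hw _; rewrite -s -e; apply: eqm_trans (hl_hact _ _) _.
  by rewrite hl_base mul1; apply: eqm_refl.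
have [k [_ eg ek]] := names_gk n; have [h' e] := aff_of_surj (hl w).
exists h'; rewrite !haffE e ek e; split=> //; congr ev.
have /(hp_edge one) : gk k w != w by apply/eqP; rewrite -eg.
by rewrite /hp !mul1 eg.
Qed.

(** Over the base word a lift is free up to its stabilizer, which is H_n; the
    edges then determine the other vertices. *)
Lemma lift_hp v pos : is_lift v pos -> exists2 kf, Hn (size v) kf &
  forall w, inEv v w -> pos w = ev (hp kf w) (xi R).
Proof.
move=> [L E]; have [h [hb [f [/inHnP [a Ha fa] e]]]] := L _ (base_inEv v).
exists (mul (aff_of h) a).
  apply: HnM Ha; have := hl_hact h (base_word v); rewrite hb hl_base size_map.
  by rewrite mul1 -[X in eqm _ _ X]one_mul => /eqm_mul.
apply: conn_ind => [|w k Hw ne ew].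
  by rewrite e fa haffE -ev_mul /hp hl_base one_mul.
have [g [h' [n eg]]] := gk_names ne.
have [k' [_ eg' ek]] := names_gk n.
have ne' : act g w <> w by rewrite eg; apply/eqP.
have [|h0 [e1 e2]] := E w g h' n; first by split=> //; exists h'.
have e3 : aff_of h0 = hp (mul (aff_of h) a) w.
  by apply: (@ev_inj R); rewrite -ew e1 haffE.
rewrite -eg e2 haffE ek e3 -hp_edge -?eg' //; exact/eqP.
Qed.

End LiftPlane.

(** * The grid, in units of one half *)

Definition cp (k : nat) (a : aff) : point :=
  (2 * a.2.1 + sgn a.1 (kap k).1, 2 * a.2.2 + sgn a.1 (kap k).2).

Definition af (f : aff) (p : point) : point :=
  (sgn f.1 p.1 + 2 * f.2.1, sgn f.1 p.2 + 2 * f.2.2).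

Definition adj (p q : point) : Prop := `|q.1 - p.1| + `|q.2 - p.2| = 1.

Lemma cp_mul k a f : cp k (mul a f) = af f (cp k a).
Proof.
rewrite /cp /af; case: (kap k) => d e; case: a f => s [x y] [s' [x' y']].
by rewrite /mul /sgn /=; case: s s' => [] [] /=; congr (_, _); lia.
Qed.

Lemma cp_rot k a : cp k (rotk k a) = cp k a.
Proof.
rewrite /cp /rotk; case: (kap k) => d e; case: a => [[] [x y]] /=; congr (_, _); lia.
Qed.

Lemma kap_mod k : kap (k %% 4) = kap k.
Proof.
rewrite {2}(divn_eq k 4); elim: (k %/ 4)%N => [|m IH]; first by rewrite mul0n.
by rewrite mulSn -addnA.
Qed.

Lemma gk_mod k : gk (k %% 4) = gk k.
Proof.
rewrite {2}(divn_eq k 4); elim: (k %/ 4)%N => [|m IH]; first by rewrite mul0n.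
by rewrite mulSn -addnA.
Qed.

Lemma cp_mod k a : cp (k %% 4) a = cp k a.
Proof. by rewrite /cp kap_mod. Qed.

Lemma rotk_mod k a : rotk (k %% 4) a = rotk k a.
Proof. by rewrite /rotk kap_mod. Qed.

Lemma eq_mod4 (T : Type) (F : nat -> T) k l :
  (forall k, F (k %% 4)%N = F k) -> k = l %[mod 4] -> F k = F l.
Proof. by move=> H e; rewrite -H e H. Qed.

(** The four classes of corners are told apart by the parities of their
    coordinates. *)
Lemma cp_class k l a b : cp k a = cp l b -> k = l %[mod 4].
Proof.
rewrite -[cp k a]cp_mod -[cp l b]cp_mod.
have: (k %% 4 < 4)%N by rewrite ltn_mod. have: (l %% 4 < 4)%N by rewrite ltn_mod.
rewrite /cp; case: a b => s [x y] [s' [x' y']] /=.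
move: (k %% 4)%N (l %% 4)%N => [|[|[|[|k']]]] [|[|[|[|l']]]] //= _ _ [];
  case: s s' => [] [] /=; lia.
Qed.

(** Exactly two squares of the color of the tree meet at a grid vertex. *)
Lemma cp_two k a b : cp k a = cp k b -> b = a \/ b = rotk k a.
Proof.
rewrite /cp /rotk; case: (kap k) => d e; case: a b => s [x y] [s' [x' y']] /= [e1 e2].
by move: e1 e2; case: s s' => [] [] /= e1 e2; [left|right|right|left];
  congr (_, (_, _)); lia.
Qed.

Lemma cp_next_rot k a : cp k.+1 (rotk k a) <> cp k.+1 a.
Proof.
by elim/four_ind: k => [||||k] //; rewrite /cp /rotk; case: a => [[] [x y]] /= -[]; lia.
Qed.

Lemma side_sq k a b : cp k a = cp k b -> cp k.+1 a = cp k.+1 b -> a = b.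
Proof. by move/cp_two => [->|->] // e; case: (@cp_next_rot k a). Qed.

Lemma side_sq_mod k l a b : cp k a = cp l b -> cp k.+1 a = cp l.+1 b ->
  k = l %[mod 4] /\ a = b.
Proof.
move=> e1 e2; have e := cp_class e1; split=> //; apply: (@side_sq k); rewrite ?e1 ?e2.
  by apply: (eq_mod4 (fun k => cp_mod k _)).
by apply: (eq_mod4 (fun k => cp_mod k _)); rewrite -[in LHS]addn1 -modnDml -e modnDml addn1.
Qed.

Lemma side_orient k l a b : cp k a = cp l.+1 b -> cp k.+1 a = cp l b -> False.
Proof. by move=> /cp_class e1 /cp_class e2; lia. Qed.

(** Every side of the grid is a side of exactly one square of the color of the
    tree, counterclockwise in exactly one direction. *)
Lemma adj_side p q : adj p q -> exists k a, [/\ (k < 4)%N &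
  (p = cp k a /\ q = cp k.+1 a) \/ (q = cp k a /\ p = cp k.+1 a)].
Proof.
case: p q => x y [x' y']; rewrite /adj /= => H.
pose t k (s : bool) (p q : point) := [&& (2 %| p.1 - (kap k).1)%Z, (2 %| p.2 - (kap k).2)%Z,
  q.1 == p.1 + sgn s ((kap k.+1).1 - (kap k).1) &
  q.2 == p.2 + sgn s ((kap k.+1).2 - (kap k).2)].
have tP k s p q : t k s p q -> exists a, p = cp k a /\ q = cp k.+1 a.
  case: p q => px py [qx qy]; rewrite /t /cp.
  move: (kap k) (kap k.+1) => [d e] [d' e'] /and4P /= [d1 d2 /eqP -> /eqP ->].
  exists (s, (((px - sgn s d) %/ 2)%Z, ((py - sgn s e) %/ 2)%Z)).
  by case: s => /=; split; congr (_, _); lia.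
suff [k [s [lk /orP [/tP [a Ha]|/tP [a Ha]]]]] : exists k s, (k < 4)%N /\
    (t k s (x, y) (x', y') || t k s (x', y') (x, y)).
- by exists k, a; split=> //; left.
- by exists k, a; split=> //; right.
have [ex|ex] : (2 %| x)%Z \/ (2 %| x - 1)%Z by lia.
all: have [ey|ey] : (2 %| y)%Z \/ (2 %| y - 1)%Z by lia.
all: have [[H1 H2]|[[H1 H2]|[[H1 H2]|[H1 H2]]]] : (x' = x + 1 /\ y' = y) \/
   (x' = x - 1 /\ y' = y) \/ (x' = x /\ y' = y + 1) \/ (x' = x /\ y' = y - 1) by lia.
all: rewrite H1 H2 /t; clear - ex ey.
all: first
  [ by exists 0%N, false; split=> //=; lia | by exists 0%N, true; split=> //=; lia
  | by exists 1%N, false; split=> //=; lia | by exists 1%N, true; split=> //=; lia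
  | by exists 2%N, false; split=> //=; lia | by exists 2%N, true; split=> //=; lia
  | by exists 3%N, false; split=> //=; lia | by exists 3%N, true; split=> //=; lia ].
Qed.

Lemma adj_cp k a : adj (cp k a) (cp k.+1 a).
Proof.
by elim/four_ind: k => [||||k] //; rewrite /adj /cp; case: a => [[] [x y]] /=; lia.
Qed.

(** * The canonical tour *)

(** The tour keeps its squares on the left, so it meets their corners in the order
    C, A, B, CAB.  A corner has the same class for both squares that meet there,
    hence this order survives the passage to another square, and before its j-th
    side the tour only has to apply the generator of the class j. *)
Fixpoint W (v : seq side) (j : nat) : word :=
  if j is j'.+1 then gk j (W v j') else base_word v.

Lemma W_inEv v j : inEv v (W v j).
Proof. by elim: j => [|j IH]; [apply: base_inEv | apply: gk_inEv]. Qed.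

Lemma WS v j : W v j.+1 = gk j.+1 (W v j).
Proof. by []. Qed.

Lemma gk_add4 m : [/\ gk (m * 4).+4 = gk 0, gk (m * 4).+1 = gk 1,
  gk (m * 4).+2 = gk 2 & gk (m * 4).+3 = gk 3].
Proof.
have e k : gk (k + m * 4) = gk k by rewrite -gk_mod addnC modnMDl gk_mod.
split; [exact: (e 4%N) | exact: (e 1%N) | exact: (e 2%N) | exact: (e 3%N)].
Qed.

Lemma W4 v m : W v (m * 4) = odo v m.
Proof.
elim: m => [|m IH]; first by rewrite mul0n odo0.
have [e0 e1 e2 e3] := gk_add4 m.
by rewrite -tau_odo -IH /tau mulSn -[(4 + _)%N]/(m * 4).+4 !WS e0 e1 e2 e3.
Qed.

(** The part of a round of four steps that comes before its k-th side. *)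
Definition sub4 (k : nat) (w : word) : word :=
  match k with 2 => ac be1 w | 3 => ac al1 (ac be1 w) | _ => w end.

Lemma W4k v m k : (k < 4)%N -> W v (k + m * 4) = sub4 k (odo v m).
Proof.
have [e0 e1 e2 e3] := gk_add4 m.
by case: k => [|[|[|[|k]]]] // _; rewrite -W4 // ?add1n ?add2n
  -?[(3 + _)%N]/(m * 4).+3 !WS ?e3 ?e2 ?e1.
Qed.

Lemma W_period v j : W v (j + 4 * 2 ^ size v) = W v j.
Proof.
elim: j => [|j IH].
  by rewrite add0n mulnC W4 -[(2 ^ _)%N]add0n odo_period odo0.
by rewrite addSn !WS IH -(gk_mod (_ + _).+1) -addSn addnC mulnC modnMDl gk_mod.
Qed.

Lemma W_surj v w k : inEv v w -> (k < 4)%N ->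
  exists j, [/\ (j < 4 * 2 ^ size v)%N, (j %% 4 = k)%N & W v j = w].
Proof.
move=> Hw lk; pose u := match k with 2 => ac be1 w | 3 => ac be1 (ac al1 w) | _ => w end.
have [|m lm em] := @odo_surj v u.
  by rewrite /u; case: k {lk u} => [|[|[|[|k]]]] //; do !apply: ac_inEv.
exists (k + m * 4)%N; split; first by lia.
  by rewrite addnC modnMDl modn_small.
rewrite W4k // em /u; case: k {lk u em} => [|[|[|[|k]]]] //=; by rewrite ?acK.
Qed.

Lemma W_inj v j l : (j < 4 * 2 ^ size v)%N -> (l < 4 * 2 ^ size v)%N ->
  j = l %[mod 4] -> W v j = W v l -> j = l.
Proof.
move=> lj ll e; rewrite (divn_eq j 4) (divn_eq l 4) e ![(_ * 4 + _)%N]addnC.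
have l4 : (l %% 4 < 4)%N by rewrite ltn_mod.
rewrite !W4k // => eo; congr (_ + _ * _)%N; apply: (@odo_inj v).
- by rewrite ltn_divLR // mulnC.
- by rewrite ltn_divLR // mulnC.
move: eo; have I g : injective (ac g) := can_inj (acK g).
by case: (l %% 4)%N l4 => [|[|[|[|k]]]] //= _; [move/I|move/I/I].
Qed.

Section Tour.

Variables (v : seq side) (kf : aff).
Hypothesis Hkf : Hn (size v) kf.

Definition V (j : nat) : point := cp j (hp kf (W v j)).

Lemma V_next j : V j.+1 = cp j.+1 (hp kf (W v j)).
Proof.
rewrite /V WS; case: (gk j.+1 (W v j) =P W v j) => [->//|/eqP ne].
by rewrite (hp_edge kf ne) cp_rot.
Qed.

Lemma V_period j : V (j + 4 * 2 ^ size v) = V j.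
Proof.
by rewrite /V W_period; apply: (eq_mod4 (fun k => cp_mod k _)); rewrite addnC mulnC modnMDl.
Qed.

(** The tour turns left at a corner through which it stays on its square, and
    right where it crosses over along an edge of the tree. *)
Definition rot90 (X : side) (p : point) : point :=
  if X is sL then (- p.2, p.1) else (p.2, - p.1).

Definition trn (j : nat) : side := if W v j.+1 == W v j then sL else sR.

Lemma V_turn j : V j.+2 - V j.+1 = rot90 (trn j) (V j.+1 - V j).
Proof.
rewrite V_next [V j.+1]V_next /V /trn.
have H X a b : (if X is sL then b = a else b = rotk j.+1 a) ->
    cp j.+2 b - cp j.+1 a = rot90 X (cp j.+1 a - cp j a).
  case: X => ->; elim/four_ind: j => [||||j] //; rewrite /cp /rotk;
   by case: a => [[] [x y]] /=; congr (_, _) => /=; lia.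
apply: H; rewrite WS; case: eqP => [->//|/eqP ne]; exact: hp_edge.
Qed.

(** The corner of an edge of the tree is met by the tour only in right turns. *)
Lemma loop_corner k l w w' f : inEv v w -> inEv v w' -> Hn (size v) f ->
  cp k (hp kf w) = cp l (mul (hp kf w') f) -> gk k w = w -> gk l w' = w'.
Proof.
move=> Hw Hw' Hf e; have ekl := cp_class e.
have eg : gk k = gk l by apply: (eq_mod4 gk_mod).
have: cp k (hp kf w) = cp k (mul (hp kf w') f).
  by rewrite e; apply: (eq_mod4 (fun k => cp_mod k _)); rewrite ekl.
rewrite -eg => {}e gw; case: (gk k w' =P w') => // /eqP ne.
have inj u u' : inEv v u -> inEv v u' -> mul (hp kf u') f = hp kf u -> u' = u.
  by move=> Hu Hu' eu; apply: (hp_inj Hkf Hu' Hu Hf (dv0 _) (f' := one)); rewrite mul1.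
case: (cp_two e) => [/inj ew|e2].
  by rewrite ew // in ne; rewrite gw eqxx in ne.
have ew : gk k w' = w.
  by apply: inj => //; [apply: gk_inEv|rewrite hp_edge // mul_rot e2 rotkK].
by move/eqP: ne; rewrite ew -gw -ew gkK.
Qed.

End Tour.

(** * Crossings in integer coordinates *)

Definition dbl (p : point) : point := (2 * p.1, 2 * p.2).

(** The center of a square, in units of one quarter. *)
Definition ctr (a : aff) : point := (sgn a.1 1 + 4 * a.2.1, sgn a.1 1 + 4 * a.2.2).

Definition detz (u w : point) : int := u.1 * w.2 - u.2 * w.1.

Definition sectorz (u u' w : point) : bool :=
  if 0 <= detz u u' then (0 < detz u w) && (0 < detz w u')
  else (0 < detz u w) || (0 < detz w u').

Definition crz (a b c d : point) : bool :=
  sectorz a b c && sectorz b a d || sectorz a b d && sectorz b a c.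

Fixpoint dirz (k : nat) : point :=
  match k with
  | 0 => (1, 0) | 1 => (0, 1) | 2 => (-1, 0) | 3 => (0, -1) | k'.+4 => dirz k'
  end.

Lemma adj_dir p q : adj p q -> exists2 k, (k < 4)%N & q = p + dirz k.
Proof.
case: p q => x y [x' y']; rewrite /adj /= => H.
have [[-> ->]|[[-> ->]|[[-> ->]|[-> ->]]]] : (x' = x + 1 /\ y' = y) \/
  (x' = x /\ y' = y + 1) \/ (x' = x - 1 /\ y' = y) \/ (x' = x /\ y' = y - 1) by lia.
- by exists 0%N => //; congr (_, _) => /=; lia.
- by exists 1%N => //; congr (_, _) => /=; lia.
- by exists 2%N => //; congr (_, _) => /=; lia.
- by exists 3%N => //; congr (_, _) => /=; lia.
Qed.

Lemma adjC p q : adj p q -> adj q p.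
Proof. by rewrite /adj; lia. Qed.

Lemma dirzP k :
  [\/ dirz k = (1, 0), dirz k = (0, 1), dirz k = (-1, 0) | dirz k = (0, -1)].
Proof. by elim/four_ind: k => [||||k IH] //; constructor. Qed.

Lemma rot90_dir X k : rot90 X (dirz k) = dirz (if X is sL then k.+1 else k.+3).
Proof. by case: X; elim/four_ind: k. Qed.

Lemma oppdir k : - dirz k = dirz k.+2.
Proof. by elim/four_ind: k. Qed.

(** A path that turns at a grid vertex bounds a quadrant there, and no grid
    direction lies strictly inside a quadrant. *)
Lemma crz_turn X k l m :
  ~~ crz (dbl (- dirz k)) (dbl (rot90 X (dirz k))) (dbl (dirz l)) (dbl (dirz m)).
Proof. by case: X; case: (dirzP k) => ->; case: (dirzP l) => ->; case: (dirzP m) => ->. Qed.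

(** A right turn leaves the two squares of the tree outside of its quadrant,
    and a left turn separates them. *)
Lemma crz_diag X (s : bool) k : let c := - dirz k + rot90 sL (dirz k) in
  crz (dbl (- dirz k)) (dbl (rot90 X (dirz k)))
      (if s then c else - c) (if s then - c else c) = (X == sL).
Proof. by rewrite /=; case: X; case: s; case: (dirzP k) => ->. Qed.

Lemma ctr_dir k a : ctr a - dbl (cp k.+1 a) =
  - (cp k.+1 a - cp k a) + rot90 sL (cp k.+1 a - cp k a).
Proof.
by elim/four_ind: k => [||||k] //; rewrite /ctr /dbl /cp; case: a => [[] [x y]] /=;
  congr (_, _) => /=; lia.
Qed.

Lemma ctr_rot k a : ctr (rotk k a) - dbl (cp k a) = - (ctr a - dbl (cp k a)).
Proof.
rewrite /ctr /dbl /cp /rotk; case: (kap k) => d e; case: a => [[] [x y]] /=;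
  congr (_, _) => /=; lia.
Qed.

Section Grid.

Variable R : realType.
Local Notation C := R[i].

Definition qv (p : point) : C := (p.1%:~R / 4) +i* (p.2%:~R / 4).

Definition gp (p : point) : C := (p.1%:~R / 2) +i* (p.2%:~R / 2).

Lemma gp_qv p : gp p = qv (dbl p).
Proof. by apply: complexP; rewrite /= intrM; lra. Qed.

Lemma qvB p q : qv p - qv q = qv (p - q).
Proof. by apply: complexP; rewrite /= intrB; lra. Qed.

Lemma ev_ctr a : ev a (xi R) = qv (ctr a).
Proof. exact: ev_xi. Qed.

Lemma ev_gp f p : ev f (gp p) = gp (af f p).
Proof.
by case: f p => [[] [x y]] [a b]; apply: complexP; rewrite /= intrD intrM ?mulrNz; lra.
Qed.

Lemma gp_inj p q : gp p = gp q -> p = q.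
Proof.
have nz : (2 : R)^-1 != 0 by rewrite invr_eq0 pnatr_eq0.
case: p q => x y [x' y'] [/(mulIf nz) e1 /(mulIf nz) e2].
by rewrite (intr_eq e1) (intr_eq e2).
Qed.

Lemma det_qv a b : det (qv a) (qv b) = (detz a b)%:~R / 16.
Proof. by rewrite /det /detz /= intrB !intrM; lra. Qed.

Lemma sector_qv a b c : in_sector (qv a) (qv b) (qv c) = sectorz a b c.
Proof.
have g (x : int) : (0 < x%:~R / 16 :> R) = (0 < x).
  by rewrite pmulr_lgt0 ?invr_gt0 ?ltr0n // ltr0z.
have h (x : int) : (0 <= x%:~R / 16 :> R) = (0 <= x).
  by rewrite pmulr_lge0 ?invr_gt0 ?ltr0n // ler0z.
by rewrite /in_sector !det_qv !g h.
Qed.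

Lemma crosses_qv p a b c d : crosses (qv p) (qv a) (qv b) (qv c) (qv d) =
  crz (a - p) (b - p) (c - p) (d - p).
Proof. by rewrite /crosses !qvB !sector_qv. Qed.

Lemma dblB p q : dbl p - dbl q = dbl (p - q).
Proof. by case: p q => x y [x' y']; congr (_, _) => /=; lia. Qed.

Lemma grid_vertexP z : grid_vertex z <-> exists p, z = gp p.
Proof.
have e2 x y : 2 * (x +i* y) = (2 * x) +i* (2 * y) :> C.
  by rewrite natcE; simpc.
split=> [/gaussianP [x [y e]]|[p ->]].
  exists (x, y); case: z e => a b; rewrite e2 => -[e1 e3].
  by apply: complexP => /=; lra.
apply/gaussianP; exists p.1, p.2; rewrite e2; apply: complexP => /=; lra.
Qed.

Lemma adj_norm p q : (`|gp q - gp p| = 1 / 2) <-> adj p q.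
Proof.
case: p q => x y [x' y'].
have -> : gp (x', y') - gp (x, y) = ((x' - x)%:~R / 2) +i* ((y' - y)%:~R / 2).
  by apply: complexP; rewrite /= intrB; lra.
rewrite /adj /=; move: (x' - x) (y' - y) => u w.
have e : (u%:~R / 2) ^+ 2 + (w%:~R / 2) ^+ 2 = (u ^+ 2 + w ^+ 2)%:~R / 4 :> R.
  by rewrite !expr2 intrD !intrM; field.
have half : 1 / 2 = ((1 / 2 : R)%:C : C).
  by rewrite (@divnatcE R 1 0 2) mul0r.
rewrite normc_def /= e half; split=> [[/(congr1 (fun x => x ^+ 2))]|H].
  rewrite sqr_sqrtr; last by rewrite divr_ge0 // ler0z addr_ge0 // sqr_ge0.
  move=> E; have : (u ^+ 2 + w ^+ 2)%:~R = 1%:~R :> R by lra.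
  by move/intr_eq; nia.
have -> : (u ^+ 2 + w ^+ 2)%:~R / 4 = (1 / 2) ^+ 2 :> R.
  have -> : u ^+ 2 + w ^+ 2 = 1 by nia.
  by lra.
by rewrite sqrtr_sqr ger0_norm // divr_ge0.
Qed.

Lemma grid_sideP z z' : grid_side z z' <->
  exists p q, [/\ z = gp p, z' = gp q & adj p q].
Proof.
split=> [[/grid_vertexP [p ->] /grid_vertexP [q ->] /adj_norm H]|[p [q [-> -> H]]]].
  by exists p, q.
by split; [apply/grid_vertexP; exists p | apply/grid_vertexP; exists q | apply/adj_norm].
Qed.

(** An edge of the tree meets the grid only at its midpoint. *)
Lemma on_edge_mid k a p :
  on_edge (qv (ctr a)) (qv (ctr (rotk k a))) (gp p) <-> p = cp k a.
Proof.
have e x y t : t%:C * (x +i* y) = (t * x) +i* (t * y) :> C.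
  by simpc.
pose c := ctr a; pose d := dbl (cp k a) - c.
have ed : qv (ctr (rotk k a)) - qv c = (d.1%:~R / 2) +i* (d.2%:~R / 2).
  rewrite qvB; have := ctr_rot k a; rewrite -/c -/d.
  move=> /(congr1 (fun x => x + dbl (cp k a))); rewrite subrK => ->.
  rewrite /d /c; apply: complexP; case: (ctr a) (cp k a) => x y [x' y'] /=;
    rewrite !(intrD, intrB, intrM, mulrNz); lra.
have pm x : x = sgn a.1 1 -> x = 1 \/ x = -1 by case: a.1 => ->; [right|left].
have [o1 o2] : (d.1 = 1 \/ d.1 = -1) /\ (d.2 = 1 \/ d.2 = -1).
  rewrite /d /c /ctr /cp /dbl; clear; elim/four_ind: k => [||||k] //=;
  case: a => [[] [x y]] /=; lia.
have [m1 m2] : (exists m, c.1 = 1 + 2 * m) /\ (exists m, c.2 = 1 + 2 * m).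
  rewrite /c /ctr; clear; case: a => [[] [x y]] /=; split.
  - by exists (2 * x - 1); lia.
  - by exists (2 * y - 1); lia.
  - by exists (2 * x); lia.
  - by exists (2 * y); lia.
rewrite /on_edge -/c ed; split=> [[t [t0 t1]]|->].
  rewrite e => /(congr1 (fun z => (complex.Re z, complex.Im z))) /= [].
  have K (x y z : int) : (y = 1 \/ y = -1) -> (exists m, z = 1 + 2 * m) ->
      (x%:~R / 2 = z%:~R / 4 + t * (y%:~R / 2) :> R) -> 2 * x = z + y.
    move=> oy [m ->] E; have E' : ((2 * x - (1 + 2 * m)) * y)%:~R = 2 * t :> R.
      rewrite intrM intrB intrM; case: oy E => ->; rewrite ?mulrNz => E; lra.
    have: 0 < (2 * x - (1 + 2 * m)) * y by rewrite -(ltr0z R) E'; lra.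
    have: (2 * x - (1 + 2 * m)) * y < 2 by rewrite -(ltr_int R) E'; lra.
    by case: oy => -> *; lia.
  move=> /(K _ _ _ o1 m1) E1 /(K _ _ _ o2 m2) E2.
  by move: E1 E2; rewrite /d /c /= [p]surjective_pairing /cp /= => E1 E2; congr (_, _); lia.
exists (1 / 2); split; [lra|lra|rewrite e].
by rewrite /d /c; apply: complexP; case: (ctr a) (cp k a) => x y [x' y'] /=;
    rewrite !(intrD, intrB, intrM, mulrNz); lra.
Qed.

Lemma corner_cp a z : corner (ev a (xi R)) z <-> exists k, z = gp (cp k a).
Proof.
have i1 p : ('i)%R * qv p = qv (rot90 sL p).
  by case: p => x y; rewrite complexi; simpc; rewrite /qv /= mulrNz mulNr.
have ik k : ('i)%R ^+ k * xi R = qv (iter k (rot90 sL) (1, 1)).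
  elim: k => [|k IH]; last by rewrite exprS -mulrA IH i1.
  by rewrite expr0 mul1r xiE.
have e k : ev a (xi R) + ('i)%R ^+ k * xi R = gp (cp (k + (if a.1 then 0 else 2)) a).
  rewrite ik ev_ctr gp_qv -[qv (iter _ _ _)]opprK -[- qv _]sub0r.
  have -> : 0 = qv 0 :> C by rewrite /qv /= mul0r.
  rewrite !qvB; congr qv.
  elim/four_ind: k => [||||k IH]; last by rewrite !iterS -IH; congr (_ - _);
    case: (iter _ _ _) => x y; rewrite /rot90 /=; congr (_, _) => /=; lia.
  1-4: by case: a => [[] [x y]]; rewrite /ctr /dbl /cp /=; congr (_, _) => /=; lia.
split=> [[k ->]|[k ->]]; first by eexists; apply: e.
exists (k + (if a.1 then 0 else 2))%N; rewrite e; congr gp.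
by clear e; case: (a.1); rewrite ?addn0 // !addn2.
Qed.

End Grid.

(** * The canonical tour goes around the tree *)

Lemma periodic_mod (T : Type) (F : nat -> T) N j :
  (forall j, F (j + N)%N = F j) -> F (j %% N)%N = F j.
Proof.
move=> H; rewrite {2}(divn_eq j N); elim: (j %/ N)%N => [|m IH]; first by rewrite mul0n.
by rewrite mulSn -addnA addnC H.
Qed.

Lemma af_sub g p q : af g p - af g q = if g.1 then - (p - q) else p - q.
Proof.
by case: g p q => [[] [x y]] [a b] [c d]; rewrite /af /=; congr (_, _) => /=; lia.
Qed.

Section Around.

Variables (R : realType) (v : seq side) (kf : aff) (pos : word -> R[i]).
Hypothesis Hkf : Hn (size v) kf.
Hypothesis posE : forall w, inEv v w -> pos w = ev (hp kf w) (xi R).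

Local Notation N := (4 * 2 ^ size v)%N.
Local Notation V := (V v kf).
Local Notation hp := (hp kf).
Local Notation gp := (gp R).

Lemma N_gt0 : (0 < N)%N.
Proof. by rewrite muln_gt0 expn_gt0. Qed.

Definition tour : seq R[i] := mkseq (fun j => gp (V j)) N.

Lemma vtx_tour j : vtx tour j = gp (V j).
Proof.
rewrite /vtx size_mkseq nth_mkseq ?ltn_mod ?N_gt0 //.
by congr gp; apply: periodic_mod => i; apply: V_period.
Qed.

Lemma V_dir j : exists k, [/\ (k < 4)%N, V j.+1 - V j = dirz k,
  V j - V j.+1 = - dirz k & V j.+2 - V j.+1 = rot90 (trn v j) (dirz k)].
Proof.
have [k lk e] : exists2 k, (k < 4)%N & V j.+1 = V j + dirz k.
  by apply: adj_dir; rewrite V_next; apply: adj_cp.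
have e1 : V j.+1 - V j = dirz k by rewrite e addrC addKr.
by exists k; split; rewrite // -?e1 ?opprB // V_turn.
Qed.

(** The sides of the squares of one color are all the sides of the grid, modulo
    H_n those squares are the vertices of the tree, and the tour visits every
    pair of a vertex and a side once because the odometer is transitive. *)
Lemma tour_eulerian : eulerian (size v) tour.
Proof.
rewrite /eulerian size_mkseq; split=> [j lj|z z' /grid_sideP [p [q [-> -> H]]]].
  rewrite !vtx_tour; apply/grid_sideP; exists (V j), (V j.+1); split=> //.
  by rewrite V_next; apply: adj_cp.
have [k [a [lk Hk]]] := adj_side H.
have [w [f [Hw Hf ea]]] := hp_surj Hkf a.
have [j [lj ej ew]] := W_surj Hw lk.
have cV l : cp l (hp (W v j)) = cp (l %% 4) (hp w) by rewrite cp_mod ew.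
have e1 : af f (V j) = cp k a by rewrite -[V j]/(cp j (hp (W v j))) cV ej -cp_mul -ea.
have e2 : af f (V j.+1) = cp k.+1 a.
  rewrite V_next cV -ej ea cp_mul -[in RHS]cp_mod; congr (af f (cp _ _)).
  by rewrite -[in RHS]addn1 modnDml addn1.
exists j; split.
  split=> //; exists (ev f); split; first by apply/inHnP; exists f.
  by rewrite !vtx_tour !ev_gp e1 e2; case: Hk => [[-> ->]|[-> ->]]; [left|right].
move=> l [ll [f' [/inHnP [g Hg fE]]]]; rewrite !vtx_tour !fE !ev_gp.
have -> : af g (V l) = cp l (mul (hp (W v l)) g) by rewrite cp_mul.
have -> : af g (V l.+1) = cp l.+1 (mul (hp (W v l)) g) by rewrite V_next cp_mul.
set b := mul _ g => Hl.
have [ekl eab] : k = l %[mod 4] /\ a = b.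
  case: Hk Hl => [[-> ->]|[-> ->]] [[/gp_inj e3 /gp_inj e4]|[/gp_inj e3 /gp_inj e4]].
  - exact: side_sq_mod (esym e3) (esym e4).
  - by case: (side_orient (esym e4) (esym e3)).
  - by case: (side_orient (esym e4) (esym e3)).
  - exact: side_sq_mod (esym e3) (esym e4).
apply: (@W_inj v) => //; first by rewrite ej -ekl modn_small.
rewrite ew; apply: (hp_inj Hkf _ _ Hf Hg); rewrite -?ea //.
exact: W_inEv.
Qed.

(** The tour turns at all of its vertices. *)
Lemma tour_no_self_crossing : no_self_crossing (size v) tour.
Proof.
move=> j k f _ _ _ /inHnP [g Hg fE]; rewrite !vtx_tour !fE !ev_gp => /gp_inj e.
have [a [_ _ ea1 ea2]] := V_dir j; have [b [_ _ eb1 eb2]] := V_dir k.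
rewrite !gp_qv crosses_qv !dblB ea1 ea2 -e !af_sub eb1 eb2.
have [l ->] : exists l, (if g.1 then - - dirz b else - dirz b) = dirz l.
  by case: g.1; rewrite ?oppdir; eexists.
have [m ->] : exists m, (if g.1 then - rot90 (trn v k) (dirz b)
                        else rot90 (trn v k) (dirz b)) = dirz m.
  by case: g.1; rewrite rot90_dir ?oppdir; eexists.
exact: crz_turn.
Qed.

(** The tour turns right where an edge of the tree meets it, by [loop_corner], and
    then [crz_diag] applies. *)
Lemma tour_no_tree_crossing : no_tree_crossing v pos tour.
Proof.
move=> j w g f _ [Hw [h n] ne] /inHnP [fa Hf fE].
have [k [_ eg _]] := names_gk n; rewrite eg in ne *; move/eqP: ne => ne.
rewrite !fE (posE Hw) (posE (gk_inEv k Hw)) hp_edge // -!ev_mul mul_rot !ev_ctr !vtx_tour.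
set b := mul _ fa => /on_edge_mid e.
have R1 : trn v j = sR.
  rewrite /trn; case: eqP => // ej; case/eqP: ne.
  apply: (loop_corner Hkf (W_inEv v j) Hw Hf _ ej).
  by rewrite -V_next.
have [d [_ ed ed1 ed2]] := V_dir j.
have ekj : k = j.+1 %[mod 4] by move: e; rewrite V_next => /cp_class.
have ec : cp k b = cp j.+1 b by apply: (eq_mod4 (fun k => cp_mod k _)).
have [s es] : exists s : bool, ctr b - dbl (V j.+1) =
    (if s then - dirz d + rot90 sL (dirz d) else - (- dirz d + rot90 sL (dirz d))).
  have c0 : ctr (hp (W v j)) - dbl (V j.+1) = - dirz d + rot90 sL (dirz d).
    by rewrite V_next ctr_dir -V_next ed.
  have : cp j.+1 (hp (W v j)) = cp j.+1 b by rewrite -ec -e V_next.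
  move/cp_two => [->|->]; [by exists true | exists false].
  by rewrite [V j.+1]V_next ctr_rot -V_next c0.
rewrite !gp_qv crosses_qv !dblB ed1 ed2 es.
have -> : ctr (rotk k b) - dbl (V j.+1) =
    if s then - (- dirz d + rot90 sL (dirz d)) else - dirz d + rot90 sL (dirz d).
  by rewrite e ctr_rot -e es; case: (s); rewrite ?opprK.
by rewrite crz_diag R1.
Qed.

Lemma tour_along : along_lift v pos tour.
Proof.
move=> j _; exists (W v j); split; first exact: W_inEv.
  by rewrite vtx_tour posE ?corner_cp; [exists j | apply: W_inEv].
by rewrite vtx_tour posE ?corner_cp; [exists j.+1; rewrite V_next | apply: W_inEv].
Qed.

Lemma tour_goes_around : goes_around v pos tour.
Proof.
split; [exact: tour_eulerian | exact: tour_no_self_crossing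
       | exact: tour_no_tree_crossing | exact: tour_along].
Qed.

End Around.

(** * Closed chains of edges separate the plane *)

(** A chain modulo 2 of edges of Sigma_1 is a set of grid vertices, their
    midpoints; its boundary counts the corners of a square in the set. *)
Definition bdry (c : point -> bool) (a : aff) : bool :=
  c (cp 0 a) (+) c (cp 1 a) (+) (c (cp 2 a) (+) c (cp 3 a)).

Definition bounded (c : point -> bool) : Prop := exists M : int, forall p, c p -> p.1 <= M.

(** The square of the other color that shares the side k with the square a,
    represented by its lower left corner. *)
Definition wl (k : nat) (a : aff) : point :=
  let n : point := match (k %% 4)%N with 0 => (0, -1) | 1 => (1, 0) | 2 => (0, 1) | _ => (-1, 0) end in
  (2 * a.2.1 - a.1%:Z + sgn a.1 n.1, 2 * a.2.2 - a.1%:Z + sgn a.1 n.2).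

Lemma wl_mod k a : wl (k %% 4) a = wl k a.
Proof. by rewrite /wl modn_mod. Qed.

Lemma wl_rot k a : wl k.+3 (rotk k a) = wl k a.
Proof.
have e3 : (k.+3 %% 4 = (k %% 4).+3 %% 4)%N by lia.
rewrite -[LHS]wl_mod -[RHS]wl_mod -rotk_mod e3.
have: (k %% 4 < 4)%N by rewrite ltn_mod.
by case: (k %% 4)%N => [|[|[|[|?]]]] // _; rewrite /wl /rotk; case: a => [[] [x y]] /=;
  congr (_, _); lia.
Qed.

Section Ray.

Variables (c : point -> bool) (M : int).
Hypothesis cM : forall p, c p -> p.1 <= M.
Hypothesis c0 : forall a, bdry c a = false.

(** The parity of the crossings of the chain with a diagonal ray, cut off after
    K steps. *)
Let f (K : nat) (x y : int) : bool := \big[addb/false]_(0 <= t < K) c (x + t%:Z + 1, y + t%:Z + 1).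

Let f_tail K L x y : (M - x <= K%:Z) ->
  \big[addb/false]_(K <= t < L) c (x + t%:Z + 1, y + t%:Z + 1) = false.
Proof.
move=> H; rewrite big_nat_cond big1 // => t; rewrite andbT => /andP [t1 t2].
by apply/negP => /cM /=; lia.
Qed.

Let fK K x y : (M - x <= K%:Z) -> f K x y = f `|M - x|%N x y.
Proof.
move=> H; rewrite /f.
have [le|lt] := leqP `|M - x|%N K.
  by rewrite (big_cat_nat (n := `|M - x|%N)) //= [X in _ (+) X]f_tail ?addbF //; lia.
by rewrite [in RHS](big_cat_nat (n := K)) //= ?[X in _ (+) X]f_tail ?addbF //; exact: ltnW.
Qed.

Let F (p : point) := f `|M - p.1|%N p.1 p.2.

Let F1 x y : F (x - 1, y - 1) = c (x, y) (+) F (x, y).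
Proof.
pose K := (`|M - x| + 2)%N; rewrite /F /= -(@fK K.+1) -?(@fK K); [|lia|lia].
rewrite /f big_nat_recl //=; congr (c (_, _) (+) _); [lia|lia|].
by apply: eq_bigr => t _; congr (c (_, _)); lia.
Qed.

Let square x y : (2 %| x - y)%Z ->
  c (x, y) (+) c (x + 1, y) (+) (c (x, y + 1) (+) c (x + 1, y + 1)) = false.
Proof.
move=> e; have [ex|ex] : (2 %| x)%Z \/ (2 %| x - 1)%Z by lia.
  rewrite -(c0 (false, ((x %/ 2)%Z, (y %/ 2)%Z))) /bdry /cp /=.
  rewrite (_ : 2 * (x %/ 2)%Z = x); last lia.
  rewrite (_ : 2 * (y %/ 2)%Z = y); last lia.
  by rewrite !addr0; congr (_ (+) _); rewrite addbC.
rewrite -(c0 (true, (((x + 1) %/ 2)%Z, ((y + 1) %/ 2)%Z))) /bdry /cp /=.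
rewrite (_ : 2 * ((x + 1) %/ 2)%Z = x + 1); last lia.
rewrite (_ : 2 * ((y + 1) %/ 2)%Z = y + 1); last lia.
rewrite !oppr0 !addr0 (_ : x + 1 + -1 = x) 1?(_ : y + 1 + -1 = y); [|lia|lia].
by case: (c (x, y)); case: (c (x + 1, y)); case: (c (x, y + 1)); case: (c (x + 1, y + 1)).
Qed.

(** Between the rays of two neighbors on the other diagonal there are only
   squares of the color of the tree, and the chain has no boundary there. *)
Let F2 x y : (2 %| x - y)%Z -> F (x - 1, y) (+) F (x, y - 1) = c (x, y).
Proof.
move=> e; pose K := (`|M - x| + 2)%N.
have tele L : f L (x - 1) y (+) f L x (y - 1) = c (x, y) (+) c (x + L%:Z, y + L%:Z).
  elim: L => [|L IH]; first by rewrite /f !big_geq // (_ : (_ + _, _ + _) = (x, y)) ?addbb //; congr (_, _); lia.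
  rewrite /f !big_nat_recr //= -/(f L _ _) -/(f L _ _).
  have e' : (2 %| (x + L%:Z) - (y + L%:Z))%Z by lia.
  have := square e'.
  rewrite (_ : x - 1 + L%:Z + 1 = x + L%:Z); last lia.
  rewrite (_ : y - 1 + L%:Z + 1 = y + L%:Z); last lia.
  rewrite (_ : x + L.+1%:Z = x + L%:Z + 1); last lia.
  rewrite (_ : y + L.+1%:Z = y + L%:Z + 1); last lia.
  move: IH.
  case: (f L _ _); case: (f L _ _); case: (c (x, y)); case: (c (x + L%:Z, y + L%:Z)) => //=;
  by case: (c (x + L%:Z + 1, y + L%:Z)); case: (c (x + L%:Z, y + L%:Z + 1));
     case: (c (x + L%:Z + 1, y + L%:Z + 1)).
rewrite /F /= -(@fK K) -?(@fK K x); [|lia|lia].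
rewrite tele (_ : c (x + K%:Z, _) = false) ?addbF //.
by apply/negP => /cM /=; lia.
Qed.

Let F1e A B P : A = (P.1 - 1, P.2 - 1) -> B = P -> F A (+) F B = c P.
Proof. by case: P => x y /= -> ->; rewrite F1 addbK. Qed.

Let F2e A B P : (2 %| P.1 - P.2)%Z -> A = (P.1 - 1, P.2) -> B = (P.1, P.2 - 1) ->
  F A (+) F B = c P.
Proof. by case: P => x y /= e -> ->; apply: F2. Qed.

(** A closed bounded chain is the boundary between the two sides of a
    2-coloring of the complementary squares. *)
Lemma coloring : exists F : point -> bool,
  forall k a, F (wl k a) (+) F (wl k.+3 a) = c (cp k a).
Proof.
exists F => k a; have e3 : (k.+3 %% 4 = (k %% 4).+3 %% 4)%N by lia.
rewrite -[wl k a]wl_mod -[wl k.+3 a]wl_mod -[cp k a]cp_mod e3.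
have: (k %% 4 < 4)%N by rewrite ltn_mod.
move: (k %% 4)%N => [|[|[|[|?]]]] // _; case: a => [[] [x y]]; rewrite /wl /cp /=.
all: first
  [ by apply: F1e; congr (_, _) => /=; lia
  | by rewrite addbC; apply: F1e; congr (_, _) => /=; lia
  | by apply: F2e => /=; [lia | congr (_, _) => /=; lia ..]
  | by rewrite addbC; apply: F2e => /=; [lia | congr (_, _) => /=; lia ..] ].
Qed.

End Ray.

Lemma bdryE k c a : bdry c a =
  c (cp k a) (+) c (cp k.+1 a) (+) (c (cp k.+2 a) (+) c (cp k.+3 a)).
Proof.
elim/four_ind: k => [||||k ->] //; rewrite /bdry.
all: case: (c (cp 0 a)) (c (cp 1 a)) (c (cp 2 a)) (c (cp 3 a)) => [] [] [] [].
all: by [].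
Qed.

Lemma bdryD c d a : bdry (fun p => c p (+) d p) a = bdry c a (+) bdry d a.
Proof.
rewrite /bdry.
case: (c (cp 0 a)) (c (cp 1 a)) (c (cp 2 a)) (c (cp 3 a)) => [] [] [] [];
case: (d (cp 0 a)) (d (cp 1 a)) (d (cp 2 a)) (d (cp 3 a)) => [] [] [] [];
by [].
Qed.

Lemma rot_neq k a : (a == rotk k a) = false.
Proof. by case: a => [[] q]; rewrite /rotk xpair_eqE. Qed.

Lemma bdry_edge k a b :
  bdry (fun p => p == cp k a) b = (b == a) (+) (b == rotk k a).
Proof.
have ne l m : l != m %[mod 4] -> (cp l b == cp m a) = false.
  by move/negP => H; apply/negP => /eqP /cp_class /eqP.
rewrite (bdryE k) (ne k.+1 k) ?(ne k.+2 k) ?(ne k.+3 k); [|lia..].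
have r0 := rot_neq k a.
have r1 : (rotk k a == a) = false by rewrite eq_sym r0.
rewrite !addbF; apply/idP/idP => [/eqP e|].
  by case: (cp_two (esym e)) => ->; rewrite eqxx ?r0 ?r1.
case: (b =P a) => [->//|_]; case: (b =P rotk k a) => [->|//] _.
by rewrite cp_rot.
Qed.

(** Counterclockwise around a corner of a come the two neighbors on the square a
    and then the two on the opposite square. *)
Lemma cp_dirs k a : exists d,
  [/\ cp k.+1 a = cp k a + dirz d, cp k.+3 a = cp k a + dirz d.+1,
      cp k.+1 (rotk k a) = cp k a + dirz d.+2 &
      cp k.+3 (rotk k a) = cp k a + dirz d.+3].
Proof.
exists (k + if a.1 then 2 else 0)%N.
elim/four_ind: k => [||||k H] //; case: a => [[] [x y]];
  by rewrite /cp /rotk; split; congr (_, _) => /=; lia.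
Qed.

Section Chains.

Variables (v : seq side) (kf : aff).
Local Notation hp := (hp kf).

Definition tree_pt (p : point) : Prop :=
  exists w k, [/\ inEv v w, gk k w != w & p = cp k (hp w)].

(** The chain is the sum of the edges of a path, by induction along the path. *)
Lemma tree_chain w1 w2 : inEv v w1 -> inEv v w2 -> exists c,
  [/\ bounded c, forall p, c p -> tree_pt p &
      forall a, bdry c a = (a == hp w1) (+) (a == hp w2)].
Proof.
suff K w : inEv v w -> exists c, [/\ bounded c, forall p, c p -> tree_pt p &
      forall a, bdry c a = (a == hp (base_word v)) (+) (a == hp w)].
  move=> /K [c1 [[M1 B1] T1 E1]] /K [c2 [[M2 B2] T2 E2]].
  exists (fun p => c1 p (+) c2 p); split=> [|p|a].
  - exists (Num.max M1 M2) => p; case e1: (c1 p) => /= H; first by move: (B1 _ e1); lia.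
    by move: (B2 _ H); lia.
  - by case e1: (c1 p) => /= H; [apply: T1 | apply: T2].
  - by rewrite bdryD E1 E2; case: eqP => _; case: eqP => _; case: eqP.
move: w; apply: conn_ind => [|w k Hw ne [c [[M B] T E]]].
  by exists (fun _ => false); split=> [|//|a]; [exists 0 | rewrite addbb].
exists (fun p => c p (+) (p == cp k (hp w))); split=> [|p|a].
- exists (Num.max M (cp k (hp w)).1) => p.
  case e1: (c p) => /= H; first by move: (B _ e1); lia.
  by rewrite (eqP H) le_max lexx orbT.
- by case e1: (c p) => /= H; [apply: T | exists w, k; rewrite (eqP H)].
- rewrite bdryD bdry_edge E hp_edge //.
  by case: eqP => _; case: eqP => _; case: eqP.
Qed.

End Chains.

(** * Uniqueness of the path around the tree *)

(** The hypotheses are the conditions on a path around the lifted tree, in integer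
    coordinates and for N steps per period.  All of them concern the plane itself:
    for a path along the lift, the conditions in the quotient imply these. *)

Section Unique.

Variables (v : seq side) (kf : aff) (N : nat) (U : nat -> point).
Local Notation hp := (hp kf).

Definition side_at (j : nat) (w : word) (k : nat) : Prop :=
  (U j = cp k (hp w) /\ U j.+1 = cp k.+1 (hp w)) \/
  (U j.+1 = cp k (hp w) /\ U j = cp k.+1 (hp w)).

Hypothesis Hkf : Hn (size v) kf.
Hypothesis N0 : (0 < N)%N.
Hypothesis Uper : forall j, U (j + N) = U j.
Hypothesis Ualong : forall j, exists w k, inEv v w /\ side_at j w k.
Hypothesis Uonto : forall w k, inEv v w -> exists j, side_at j w k.
Hypothesis Uinj : forall i j, (U i = U j /\ U i.+1 = U j.+1) \/
  (U i = U j.+1 /\ U i.+1 = U j) -> i = j %[mod N].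
Hypothesis Uself : forall i j, i <> j %[mod N] -> U j.+1 = U i.+1 ->
  ~~ crz (dbl (U i - U i.+1)) (dbl (U i.+2 - U i.+1))
         (dbl (U j - U i.+1)) (dbl (U j.+2 - U i.+1)).
Hypothesis Utree : forall i w k, inEv v w -> gk k w != w -> U i.+1 = cp k (hp w) ->
  ~~ crz (dbl (U i - U i.+1)) (dbl (U i.+2 - U i.+1))
         (ctr (hp w) - dbl (U i.+1)) (- (ctr (hp w) - dbl (U i.+1))).

Let Umod i j : i = j %[mod N] -> U i = U j.
Proof.
move=> e; rewrite -(periodic_mod i Uper) e; exact: (periodic_mod j Uper).
Qed.

Let UmodS i j : i = j %[mod N] -> U i.+1 = U j.+1.
Proof. by move=> e; apply: Umod; rewrite -!(addn1 i) -(addn1 j) -modnDml e modnDml. Qed.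

(** Passages are taken without their direction: the rules below do not depend on
    it, and so the path and its reverse are treated together. *)
Definition pass (p a b : point) : Prop := exists i, U i.+1 = p /\
  ((U i = a /\ U i.+2 = b) \/ (U i = b /\ U i.+2 = a)).

Let passC p a b : pass p a b -> pass p b a.
Proof. by case=> i [e [H|H]]; exists i; split=> //; [right|left]. Qed.

Let pass_of i : pass (U i.+1) (U i) (U i.+2).
Proof. by exists i; split=> //; left. Qed.

Let Uadj i : U i <> U i.+1.
Proof.
have [w [k [_ H]]] := Ualong i; move=> e.
by case: H => [[e1 e2]|[e1 e2]]; have := adj_cp k (hp w);
  rewrite -e1 -e2 e /adj !subrr.
Qed.

Let pass_inj p a b b' : pass p a b -> pass p a b' -> b = b'.
Proof.
move=> [i [ei Hi]] [j [ej Hj]].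
case: Hi Hj => [[a1 b1]|[b1 a1]] [[a2 b2]|[b2 a2]].
- have e : i = j %[mod N] by apply: Uinj; left; rewrite a1 a2 ei ej.
  by rewrite -b1 -b2; apply: (UmodS (i := i.+1) (j := j.+1)); rewrite -!(addn1 i) -(addn1 j) -modnDml e modnDml.
- have e : i = j.+1 %[mod N] by apply: Uinj; right; rewrite a1 a2 ei ej.
  by case: (@Uadj i); rewrite (Umod e) ei ej.
- have e : i.+1 = j %[mod N] by apply: Uinj; right; rewrite a1 a2 ei ej.
  by case: (@Uadj j); rewrite -(Umod e) ei ej.
- have e : i.+1 = j.+1 %[mod N] by apply: Uinj; left; rewrite a1 a2 ei ej.
  rewrite -b1 -b2; apply: Umod; apply/eqP; rewrite -(eqn_modDr 1) !addn1; exact/eqP.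
Qed.

Let pass_neq p a : ~ pass p a a.
Proof.
move=> [i [e H]]; have e2 : U i = U i.+2 by case: H => [[-> ->]|[-> ->]].
have := @Uinj i i.+1 (or_intror (conj e2 erefl)) => /Umod; exact: Uadj.
Qed.

Let pass_ex p q j : (U j = p /\ U j.+1 = q) \/ (U j.+1 = p /\ U j = q) ->
  exists b, pass p q b.
Proof.
case=> [[e1 e2]|[e1 e2]].
  exists (U (j + N).-1), (j + N).-1.
  have e : ((j + N).-1.+1 = j + N)%N by rewrite prednK // addn_gt0 N0 orbT.
  by rewrite e -addSn Uper e1; split=> //; right; rewrite Uper.
by exists (U j.+2), j; split=> //; left.
Qed.

Section Corner.

Variables (k : nat) (w : word).
Hypothesis Hw : inEv v w.

Local Notation sq := (hp w).
Local Notation pc := (cp k sq).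
Local Notation q0 := (cp k.+1 sq).
Local Notation q1 := (cp k.+3 sq).
Local Notation q2 := (cp k.+1 (rotk k sq)).
Local Notation q3 := (cp k.+3 (rotk k sq)).

Let nbr q : adj pc q -> [\/ q = q0, q = q1, q = q2 | q = q3].
Proof.
move=> /adj_dir [m lm ->]; have [d [-> -> -> ->]] := cp_dirs k sq.
have: exists n, (m = n + d %[mod 4])%N /\ (n < 4)%N.
  by exists ((m + 3 * d) %% 4)%N; split; lia.
have dm l : dirz (l %% 4) = dirz l by apply: periodic_mod => j; rewrite addnC.
move=> [[|[|[|[|?]]]] [e]] // _; rewrite -(dm m) e dm.
- by constructor 1.
- by constructor 2.
- by constructor 3.
- by constructor 4.
Qed.

Let pass_adj x b : pass pc x b -> adj pc b.
Proof.
have A i : adj (U i) (U i.+1).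
  by have [w' [l [_ [[-> ->]|[-> ->]]]]] := Ualong i; [|apply: adjC]; apply: adj_cp.
by move=> [i [<- [[_ <-]|[<- _]]]]; [|apply: adjC]; apply: A.
Qed.

Lemma neighbors_distinct : [/\ q0 <> q1, q0 <> q2, q0 <> q3, q1 <> q2 & q1 <> q3] /\ q2 <> q3.
Proof.
have [d [-> -> -> ->]] := cp_dirs k sq.
have I x y : dirz x <> dirz y -> pc + dirz x <> pc + dirz y.
  by move=> ne /addrI.
by split; [split|]; apply: I; clear; elim/four_ind: d => [||||//].
Qed.

(** The other two sides at pc belong to no other square of the color of the tree. *)
Lemma opposite_in_tree x y : pass pc x y -> y = q2 \/ y = q3 ->
  exists w2, inEv v w2 /\ hp w2 = rotk k sq.
Proof.
move=> H Hy; have [i [w' [l [Hw' S Hi]]]] : exists i w' l, [/\ inEv v w', side_at i w' l &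
    (U i = pc /\ U i.+1 = y) \/ (U i.+1 = pc /\ U i = y)].
  case: H => i [ei [[_ e]|[e _]]].
    by have [w' [l [Hw' S]]] := Ualong i.+1; exists i.+1, w', l; split=> //; left.
  by have [w' [l [Hw' S]]] := Ualong i; exists i, w', l; split=> //; right.
exists w'; split=> //; have [[n01 n02 n03 n12 n13] n23] := neighbors_distinct.
have [m [e1 e2]] : exists m, pc = cp m (hp w') /\ (y = cp m.+1 (hp w') \/ y = cp m.+3 (hp w')).
  case: S Hi => [[e1 e2]|[e1 e2]] [[e3 e4]|[e3 e4]]; rewrite -e3 -e4 e1 e2.
  - by exists l; split=> //; left.
  - by exists l.+1; split=> //; right.
  - by exists l.+1; split=> //; right.
  - by exists l; split=> //; left.
have emk := cp_class e1.
have em (b : aff) n : cp (m + n) b = cp (k + n) b.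
  by apply: (eq_mod4 (fun k => cp_mod k b)); rewrite -modnDml -emk modnDml.
move: e1 e2; rewrite -[m]addn0 -!addnS !em addn0 => /cp_two [->|->] //.
rewrite !addnS !addn0 => e2.
by case: e2 Hy n02 n03 n12 n13 => -> [] ->.
Qed.

Lemma partner0 : exists b, pass pc q0 b.
Proof.
by have [j [H|[H1 H2]]] := Uonto k Hw; apply: (@pass_ex _ _ j); [left|right].
Qed.

Lemma partner1 : exists b, pass pc q1 b.
Proof.
by have [j [[H1 H2]|[H1 H2]]] := Uonto k.+3 Hw; apply: (@pass_ex _ _ j); [right|left].
Qed.

Let no_cross : pass pc q0 q2 -> pass pc q1 q3 -> False.
Proof.
move=> [i [ei Hi]] [l [el Hl]].
have [[n01 n02 n03 n12 n13] n23] := neighbors_distinct.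
have ne : i <> l %[mod N].
  by move=> /Umod e; case: Hi Hl => [[e1 e2]|[e1 e2]] [[e3 e4]|[e3 e4]];
    rewrite e1 e3 in e; congruence.
have := Uself ne; rewrite ei el => /(_ erefl).
have [d [d0 d1 d2 d3]] := cp_dirs k sq.
have S x : pc + x - pc = x by rewrite addrC addKr.
case: Hi Hl => [[-> ->]|[-> ->]] [[-> ->]|[-> ->]];
  rewrite d0 d1 d2 d3 !S; by elim/four_ind: d {d0 d1 d2 d3}.
Qed.

(** If one pass goes straight ahead, both squares at the corner are in the tree,
    so the other two sides are also in the path; they can only be joined to each
    other, and the two passes cross. *)
Let straight : ~ pass pc q0 q2 /\ ~ pass pc q1 q3.
Proof.
have [[n01 n02 n03 n12 n13] n23] := neighbors_distinct.
split=> H.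
  have [b Hb] := partner1; case: (nbr (pass_adj Hb)) => eb; subst b.
  - by case: n12; apply: esym; apply: (pass_inj H (passC Hb)).
  - exact: pass_neq Hb.
  - by case: n01; apply: (pass_inj (passC H) (passC Hb)).
  - exact: no_cross H Hb.
have [b Hb] := partner0; case: (nbr (pass_adj Hb)) => eb; subst b.
- exact: pass_neq Hb.
- by case: n03; apply: esym; apply: (pass_inj H (passC Hb)).
- exact: no_cross Hb H.
- by case: n01; apply: esym; apply: (pass_inj (passC H) (passC Hb)).
Qed.

Lemma left_or_right x : (pass pc q0 x -> x = q1 \/ x = q3) /\
                      (pass pc q1 x -> x = q0 \/ x = q2).
Proof.
have [s0 s1] := straight.
split=> H; case: (nbr (pass_adj H)) => ex; subst x;
  try (by left); try (by right); try (by case: (pass_neq H)); try by [].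
Qed.

(** Such a pass separates the two ends of the edge. *)
Lemma tree_corner : gk k w != w -> ~ pass pc q0 q1.
Proof.
move=> ne [i [ei Hi]]; have := Utree Hw ne ei; rewrite ei.
have [d [d0 d1 d2 d3]] := cp_dirs k sq.
have S x : pc + x - pc = x by rewrite addrC addKr.
have -> : ctr (hp w) - dbl pc = dirz d + dirz d.+1.
  have : ctr sq - dbl pc = (q0 - pc) + (q1 - pc).
    clear; move: sq => b; elim/four_ind: k => [||||//]; case: b => [[] [x y]];
      by rewrite /ctr /dbl /cp /=; congr (_, _) => /=; lia.
  by rewrite d0 d1 !S.
by case: Hi => [[-> ->]|[-> ->]]; rewrite d0 d1 !S;
  elim/four_ind: d {d0 d1 d2 d3}.
Qed.

End Corner.

Let side_at_eq i w l w' l' : side_at i w l -> side_at i w' l' ->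
  l = l' %[mod 4] /\ hp w = hp w'.
Proof.
move=> [[e1 e2]|[e1 e2]] [[]|[]]; rewrite e1 e2 => e3 e4.
- exact: side_sq_mod.
- by case: (side_orient e4 e3).
- by case: (side_orient e4 e3).
- exact: side_sq_mod.
Qed.

Let wlS4 l b : wl l.+4 b = wl l b.
Proof. by rewrite -[RHS]wl_mod -[LHS]wl_mod; congr (wl _ b); lia. Qed.

Section White.

Variables (k : nat) (w : word).
Hypotheses (Hw : inEv v w) (gw : gk k w = w).

Local Notation sq := (hp w).
Local Notation pc := (cp k sq).
Local Notation q0 := (cp k.+1 sq).
Local Notation q1 := (cp k.+3 sq).
Local Notation q2 := (cp k.+1 (rotk k sq)).
Local Notation q3 := (cp k.+3 (rotk k sq)).

Hypothesis P03 : pass pc q0 q3.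

(** Suppose that the path crosses over at a corner pc that is not on an edge of the
    tree.  The path in the tree between the two squares at pc, closed up through
    pc, is a closed chain.  It separates the two complementary squares at pc, and
    the path around the tree has sides on both of them; but the path never
    crosses the chain. *)
Lemma white_absurd : False.
Proof.
have [[n01 n02 n03 n12 n13] n23] := neighbors_distinct k w.
have [w2 [Hw2 ew2]] := opposite_in_tree P03 (or_intror erefl).
have [c0 [[M0 B0] T E]] := tree_chain kf Hw Hw2.
pose c x := c0 x (+) (x == pc).
have [M B] : bounded c.
  exists (Num.max M0 pc.1) => x; rewrite /c; case e1: (c0 x) => /= H.
    by move: (B0 _ e1); lia.
  by rewrite (eqP H) le_max lexx orbT.
have Cl a : bdry c a = false.
  by rewrite bdryD bdry_edge E ew2; case: eqP => _; case: eqP.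
have c0F l w' : inEv v w' -> gk l w' = w' -> c0 (cp l (hp w')) = false.
  move=> Hw' gw'; apply/negP => /T [w3 [l3 [Hw3 /eqP ne e]]]; apply: ne.
  by apply: (loop_corner Hkf Hw' Hw3 (dv0 _) (f := one) _ gw'); rewrite mul1.
have [F HF] := coloring B Cl.
(* A pass around one square meets the chain in no point. *)
have black l w' : inEv v w' -> pass (cp l (hp w')) (cp l.+1 (hp w')) (cp l.+3 (hp w')) ->
    F (wl l (hp w')) = F (wl l.+3 (hp w')).
  move=> Hw' H; suff cF : c (cp l (hp w')) = false.
    by have := HF l (hp w'); rewrite cF; case: (F _) (F _) => [] [].
  rewrite /c c0F //; last by apply/eqP/negPn/negP => /(tree_corner Hw'); apply.
  apply/eqP => e; have ekl := cp_class e.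
  have em n b : cp (l + n) b = cp (k + n) b.
    by apply: (eq_mod4 (fun k => cp_mod k b)); rewrite -modnDml ekl modnDml.
  move: H; rewrite -[l]addn0 -!addnS !em addn0 !addnS addn0.
  have : cp k sq = cp k (hp w') by rewrite -e -[k]addn0 -em addn0.
  move/cp_two => [->|->]; rewrite ?cp_rot => H.
    by case: n13; apply: (pass_inj H P03).
  by case: n02; apply: (pass_inj (passC P03) (passC H)).
pose Lab i b := exists w' l, [/\ inEv v w', side_at i w' l & F (wl l (hp w')) = b].
have LabS i b : Lab i b -> Lab i.+1 b.
  move=> [w' [l [Hw' S eb]]]; have Hp := pass_of i.
  case: S => [[e1 e2]|[e1 e2]].
    have {}e1 : U i = cp l.+1.+3 (hp w') by [].
    have := Hp; rewrite e1 e2 => Hq; have [_ /(_ Hq) [e3|e3]] := left_or_right l.+1 Hw' (U i.+2).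
      exists w', l.+1; split=> //; first by left.
      by rewrite e3 in Hq; rewrite black ?wlS4 //; apply: passC.
    have [w4 [Hw4 ew4]] := opposite_in_tree Hq (or_introl e3).
    exists w4, l.+1; split=> //; first by left; rewrite e2 e3 ew4 cp_rot.
    by rewrite ew4 -wl_rot rotkK wlS4.
  have := Hp; rewrite e1 e2 => Hq; have [/(_ Hq) [e3|e3] _] := left_or_right l Hw' (U i.+2).
    exists w', l.+3; split=> //; first by right; rewrite e3 e1.
    by rewrite e3 in Hq; rewrite -black.
  have [w4 [Hw4 ew4]] := opposite_in_tree Hq (or_intror e3).
  exists w4, l.+3; split=> //; first by right; rewrite e3 e1 ew4 -(cp_rot l).
  by rewrite ew4 wl_rot.
have [w0 [l0 [Hw0 S0]]] := Ualong 0.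
have Lab0 i : Lab i (F (wl l0 (hp w0))).
  by elim: i => [|i IH]; [exists w0, l0 | apply: LabS].
have Fw l : F (wl l sq) = F (wl l0 (hp w0)).
  have [j Sj] := Uonto l Hw; have [w' [l' [Hw' S' <-]]] := Lab0 j.
  have [el ->] := side_at_eq Sj S'; congr F.
  by apply: (eq_mod4 (fun k => wl_mod k _)).
have := HF k sq; rewrite !Fw addbb /c c0F // eqxx; by [].
Qed.

End White.

Let black_pass k w : inEv v w -> gk k w = w ->
  ~ pass (cp k (hp w)) (cp k.+1 (hp w)) (cp k.+3 (rotk k (hp w))) /\
  ~ pass (cp k (hp w)) (cp k.+3 (hp w)) (cp k.+1 (rotk k (hp w))).
Proof.
move=> Hw gw; have [[n01 n02 n03 n12 n13] n23] := neighbors_distinct k w.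
split=> H; apply: (white_absurd Hw gw) => //.
have [b Hb] := partner0 k Hw; have [/(_ Hb) [eb|<- //] _] := left_or_right k Hw b.
by rewrite eb in Hb; case: n02; apply: (pass_inj (passC Hb) H).
Qed.

(** Hence the path passes every corner as the canonical tour does. *)
Let rule k w x : inEv v w ->
  (pass (cp k (hp w)) (cp k.+1 (hp w)) x -> x = cp k.+3 (hp (gk k w))) /\
  (pass (cp k (hp w)) (cp k.+3 (hp w)) x -> x = cp k.+1 (hp (gk k w))).
Proof.
move=> Hw; have [L1 L2] := left_or_right k Hw x.
case: (gk k w =P w) => [e|/eqP ne].
  have [b1 b2] := black_pass Hw e; rewrite e.
  by split=> H; [case: (L1 H) | case: (L2 H)] => // ex; rewrite ex in H.
have tr := tree_corner Hw ne; rewrite hp_edge //.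
by split=> H; [case: (L1 H) | case: (L2 H)] => // ex; rewrite ex in H => //;
  case: tr => //; apply: passC.
Qed.

Local Notation NV := (4 * 2 ^ size v)%N.
Local Notation V := (V v kf).

Let forward i j : U j = V i -> U j.+1 = V i.+1 -> forall l, U (j + l) = V (i + l).
Proof.
move=> e0 e1 l; suff [] : U (j + l) = V (i + l) /\ U (j + l).+1 = V (i + l).+1 by [].
elim: l => [|l [IH1 IH2]]; first by rewrite !addn0.
rewrite !addnS; split=> //; have := pass_of (j + l); rewrite IH1 IH2 V_next => H.
have [_ /(_ H) ->] := rule (i + l).+1 (U (j + l).+2) (W_inEv v (i + l)).
by rewrite V_next.
Qed.

Let backward i j : U j = V i.+1 -> U j.+1 = V i ->
  forall l, (l <= i.+1)%N -> U (j + l) = V (i.+1 - l).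
Proof.
elim: i j => [|i IH] j e0 e1 [|l] // ll; rewrite ?addn0 ?subn0 //.
  by case: l ll => [|l] // _; rewrite addn1 e1.
rewrite addnS -addSn subSS; apply: IH => //.
have := pass_of j; rewrite e0 e1 [V i.+2]V_next => H.
have [/(_ H) -> _] := rule i.+1 (U j.+2) (W_inEv v i.+1).
by rewrite WS gkK.
Qed.

Let V_side_inj i j : V i = V j -> V i.+1 = V j.+1 -> i = j %[mod NV].
Proof.
rewrite ![V _.+1]V_next => e1 e2; have [e4 eh] := side_sq_mod e1 e2.
have WM l : W v (l %% NV) = W v l by apply: periodic_mod => x; apply: W_period.
apply: (@W_inj v); rewrite ?ltn_mod ?N_gt0 //.
  by rewrite !(modn_dvdm _ (dvdn_mulr _ (dvdnn 4))).
by rewrite !WM; apply/esym/(hp_inj1 Hkf); rewrite ?eh //; apply: W_inEv.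
Qed.

(** One side and its direction determine the path, since all passes are known. *)
Lemma unique_tour : N = NV /\ exists m,
  (forall j, U j = V (m + j)) \/ (forall j, (j <= m + NV)%N -> U j = V (m + NV - j)).
Proof.
have [w [k [Hw S]]] := Ualong 0.
have [m [lm em ew]] : exists m, [/\ (m < NV)%N, (m %% 4 = k %% 4)%N & W v m = w].
  by apply: W_surj; rewrite ?ltn_mod.
have c4 l : cp (k + l) (hp w) = cp (m + l) (hp w).
  by apply: (eq_mod4 (fun k => cp_mod k _)); rewrite -modnDml -em modnDml.
have VP i : V (i + NV) = V i by apply: V_period.
have e0 : cp k (hp w) = V m by have := c4 0%N; rewrite !addn0 -ew.
have e1 : cp k.+1 (hp w) = V m.+1 by have := c4 1%N; rewrite !addn1 -ew V_next.
move: S; rewrite /side_at e0 e1 => -[[s0 s1]|[s1 s0]].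
  have FW l : U l = V (m + l) by rewrite -(forward s0 s1).
  split; last by exists m; left.
  have d1 : 0 = NV %[mod N].
    by apply: Uinj; left; rewrite !FW (addnS m NV) -addSn !VP addn0 addn1.
  have d2 : (m + N)%N = m %[mod NV].
    apply: V_side_inj; first by rewrite -FW -[N]add0n Uper FW addn0.
    by rewrite -addnS -FW -add1n Uper FW addn1.
  have {}d1 : (N %| NV)%N by rewrite /dvdn -d1 mod0n.
  have {}d2 : (NV %| N)%N.
    have : (m + N == m + 0 %[mod NV])%N by rewrite addn0 d2.
    by rewrite eqn_modDl mod0n.
  by apply/eqP; rewrite eqn_dvd d1.
pose i := (m + NV)%N.
have BW l : (l <= i.+1)%N -> U l = V (i.+1 - l).
  by apply: (backward (j := 0)); rewrite ?s0 ?s1 /i -?addSn VP.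
have NV0 := N_gt0 v.
split; last by exists m.+1; right=> j lj; rewrite BW /i // addSn.
have d1 : 0 = NV %[mod N].
  apply: Uinj; left; rewrite !BW /i; try lia.
  have -> : ((m + NV).+1 - NV = m.+1)%N by lia.
  have -> : ((m + NV).+1 - NV.+1 = m)%N by lia.
  by rewrite subn0 subn1 -addSn !VP.
have {}d1 : (N %| NV)%N by rewrite /dvdn -d1 mod0n.
have lN : (N <= NV)%N by apply: dvdn_leq.
have d2 : (i - N)%N = i %[mod NV].
  have u0 := Uper 0; have u1 := Uper 1.
  apply: V_side_inj.
    by move: u1; rewrite !BW /i; try lia; rewrite add1n subSS subSS subn0.
  move: u0; rewrite !BW /i; try lia; rewrite add0n subn0 => <-.
  by congr V; lia.
have {}d2 : (NV %| N)%N.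
  have : (i - N + N == i - N + 0 %[mod NV])%N by rewrite addn0 d2 subnK // /i; lia.
  by rewrite eqn_modDl mod0n.
by apply/eqP; rewrite eqn_dvd d1.
Qed.

End Unique.

(** * The turns of the tour and of the folded strip *)

(** The turns of the strip folded according to v, extended periodically, if the
    last letter of v is [sL].  Around the tree the last letter makes no difference,
    as the loops at the last level are the same for both letters; [closed_turn_rev]
    reduces the folded strip to that case. *)
Fixpoint fold_turn (v : seq side) (j : nat) : side :=
  match v with
  | X :: (_ :: _) as v' => if odd j then fold_turn v' j./2
                           else if odd j./2 then flip X else X
  | _ => sL
  end.

Definition be_turn (w : word) : side := if ac be1 w == w then sL else sR.

Definition ga_turn (w : word) : side :=
  let u := ac al1 (ac be1 w) in if ac ga1 u == u then sL else sR.

Lemma consE (x : letter) (u u' : word) : (x :: u == x :: u') = (u == u').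
Proof. by rewrite eqseq_cons eqxx. Qed.

Lemma be_turn_cons X b u : u != [::] ->
  be_turn ((X, b) :: u) = if b then flip X else X.
Proof.
move=> nu; have al (u' : word) : u' != [::] -> (ac al1 u' == u') = false.
  by move=> H; apply/negbTE/ac_al1_neq.
have be : ac be1 u != [::] by rewrite -size_eq0 size_ac size_eq0.
rewrite /be_turn acE; case: X b => [] [] /=; rewrite ?eqxx // consE ?al //.
by rewrite -{2}[u](acK be1) (inj_eq (can_inj (acK be1))) al.
Qed.

Lemma ga_turn_cons X b u :
  ga_turn ((X, b) :: u) = if b then ga_turn u else be_turn u.
Proof.
rewrite /ga_turn /be_turn; case: X b => [] [];
  rewrite [ac be1 (_ :: _)]acE /= [ac al1 (_ :: _)]acE /= [ac ga1 (_ :: _)]acE /=;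
  by rewrite consE ?acK // eq_sym.
Qed.

(** A turn on the tail comes between any two turns that are decided by the first
    letter, and these alternate: the rule of paper folding. *)
Lemma tour_turn v m : be_turn (odo v m) = fold_turn v m.*2 /\
  ga_turn (odo v m) = fold_turn v m.*2.+1.
Proof.
elim: v m => [|X [|Y v] IH] m.
- by rewrite /be_turn /ga_turn /= !ac_nil.
- by rewrite /= ga_turn_cons /be_turn /ga_turn acE; case: X (odd m) => [] [] /=;
    rewrite !ac_nil eqxx.
have nu : odo (Y :: v) m./2 != [::] by [].
rewrite [odo _ _]/= -/(odo (Y :: v) m./2) be_turn_cons // ga_turn_cons.
have [IHb IHg] := IH m./2.
have -> : fold_turn [:: X, Y & v] m.*2 = if odd m then flip X else X.
  by rewrite /= odd_double doubleK.
have -> : fold_turn [:: X, Y & v] m.*2.+1 = fold_turn (Y :: v) m.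
  by rewrite /= odd_double /= uphalf_double.
split=> //; rewrite IHb IHg -[in RHS](odd_double_half m); by case: (odd m).
Qed.

(** The corners of A and CAB give alternating turns as if they came from one more
    letter [sL]. *)
Lemma trnE v j : trn v j = fold_turn (sL :: v) j.
Proof.
rewrite (divn_eq j 4) addnC; set m := (j %/ 4)%N.
have := ltn_pmod j (isT : (0 < 4)%N); case: v => [|X v].
  have W0 i : W [::] i = [::].
    by have := W_inEv [::] i; rewrite /Defs.inE; case: (W _ _).
  by rewrite /trn !W0.
have nu i : odo (X :: v) i != [::] by [].
have [eb eg] := tour_turn (X :: v) m.
have F i : fold_turn [:: sL, X & v] i =
  if odd i then fold_turn (X :: v) i./2 else if odd i./2 then sR else sL by [].
rewrite /trn F; case: (j %% 4)%N => [|[|[|[|?]]]] // _; rewrite -addSn.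
- have -> : odd (0 + m * 4) = false by lia.
  have -> : odd (0 + m * 4)./2 = false by lia.
  by rewrite !W4k //= eqxx.
- have -> : odd (1 + m * 4) = true by lia.
  have -> : ((1 + m * 4)./2 = m.*2)%N by lia.
  by rewrite !W4k // -eb.
- have -> : odd (2 + m * 4) = false by lia.
  have -> : odd (2 + m * 4)./2 = true by lia.
  by rewrite !W4k //= (negbTE (ac_al1_neq _)) // -size_eq0 size_ac.
- have -> : odd (3 + m * 4) = true by lia.
  have -> : ((3 + m * 4)./2 = m.*2.+1)%N by lia.
  by rewrite -[(4 + _)%N]/(m.+1 * 4)%N W4 W4k // -eg -tau_odo.
Qed.

Lemma flipK : involutive flip.
Proof. by case. Qed.

Lemma iter_flip n X : iter n flip X = if odd n then flip X else X.
Proof. by elim: n => //= n ->; case: (odd n) => //=; rewrite flipK. Qed.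

(** The last fold inserts bends of alternating directions between those of the
    strip folded before. *)
Fixpoint inter (X : side) (t : seq side) : seq side :=
  if t is Y :: t' then [:: X, Y & inter (flip X) t'] else [:: X].

Lemma size_inter X t : size (inter X t) = (size t).*2.+1.
Proof. by elim: t X => //= Y t IH X; rewrite IH. Qed.

Lemma inter_cat X t Y s :
  inter X (t ++ Y :: s) = inter X t ++ Y :: inter (iter (size t).+1 flip X) s.
Proof. by elim: t X => [|Z t IH] X //=; rewrite IH -iterSr. Qed.

Lemma rev_inter X t : rev (map flip (inter X t)) =
  inter (iter (size t).+1 flip X) (rev (map flip t)).
Proof.
elim: t X => [|Y t IH] X //=; rewrite !rev_cons IH -!cats1 -catA inter_cat.
rewrite size_rev size_map -iterSr; congr (_ ++ [:: _; _]).
by rewrite flipK -iterD iter_flip addSn addnn /= odd_double.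
Qed.

Lemma nth_inter X Y t i : (i < (size t).+1.*2)%N ->
  nth sL (rcons (inter X t) Y) i =
  if odd i then nth sL (rcons t Y) i./2 else iter i./2 flip X.
Proof.
elim: t X i => [|Z t IH] X [|[|i]] //=.
rewrite doubleS !ltnS => li; rewrite IH // negbK -iterSr; by case: (odd i).
Qed.

Lemma bends_cons X v : bends (X :: v) = inter X (bends v).
Proof.
rewrite /bends /=; suff H t : foldl (fun t X => t ++ X :: rev (map flip t)) (inter X t) v =
  inter X (foldl (fun t X => t ++ X :: rev (map flip t)) t v) by exact: (H [::]).
elim: v t => [|Y v IH] t //=.
by rewrite -IH inter_cat rev_inter.
Qed.

Lemma bends_rcons v X : bends (rcons v X) = bends v ++ X :: rev (map flip (bends v)).
Proof. by rewrite /bends foldl_rcons. Qed.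

Lemma size_bends v : (size (bends v)).+1 = (2 ^ size v)%N.
Proof.
by elim: v => // X v IH; rewrite bends_cons size_inter /= -doubleS IH expnS mul2n.
Qed.

(** Turning the strip over exchanges its ends and the direction of its last
    bend. *)
Lemma rev_bends v X : rev (map flip (bends (rcons v X))) = bends (rcons v (flip X)).
Proof.
rewrite !bends_rcons map_cat rev_cat /= rev_cons -cats1 -catA /= map_rev revK.
by rewrite -map_comp (eq_map (g := id)) ?map_id // => x /=; rewrite flipK.
Qed.

Lemma fold_turnE v X j :
  nth sL (rcons (bends (rcons v sL)) sL) (j %% 2 ^ (size v).+1) =
  fold_turn (rcons v X) j.
Proof.
elim: v j => [|Y v IH] j.
  by rewrite /=; have := ltn_pmod j (isT : (0 < 2)%N); case: (j %% 2)%N => [|[|?]].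
have s : size (rcons v sL) = (size v).+1 by rewrite size_rcons.
set M := (2 ^ (size v).+1)%N.
have eM : (2 ^ (size (Y :: v)).+1 = M.*2)%N by rewrite expnS mul2n.
have M2 : M = (2 ^ size v).*2 by rewrite /M expnS mul2n.
have M0 : (0 < 2 ^ size v)%N by rewrite expn_gt0.
rewrite eM rcons_cons bends_cons nth_inter; last first.
  by rewrite size_bends s -/M ltn_mod double_gt0 /M expn_gt0.
have e1 : odd (j %% M.*2) = odd j.
  by apply: odd_mod; rewrite odd_double.
have e2 : ((j %% M.*2)./2 = j./2 %% M)%N.
  by rewrite -!divn2 -muln2 modn_divl.
have e3 : odd (j./2 %% M) = odd j./2 by apply: odd_mod; rewrite M2 odd_double.
rewrite e1 e2 iter_flip e3 IH; case: v {IH s M eM M2 M0 e1 e2 e3} => //.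
Qed.

Section Bridge.

Variables (R : realType) (v : seq side) (kf : aff) (pos : word -> R[i]).
Hypothesis Hkf : Hn (size v) kf.
Hypothesis posE : forall w, inEv v w -> pos w = ev (hp kf w) (xi R).

Local Notation NV := (4 * 2 ^ size v)%N.
Local Notation V := (V v kf).
Local Notation hp := (hp kf).
Local Notation gp := (gp R).
Local Notation tour := (tour R v kf).

Definition grid_coord (z : R[i]) : point :=
  (Num.floor (2 * complex.Re z), Num.floor (2 * complex.Im z)).

Lemma gpK : cancel gp grid_coord.
Proof.
by case=> x y; rewrite /grid_coord /=; congr (_, _);
  rewrite mulrC divfK ?pnatr_eq0 // intrKfloor.
Qed.

(** A grid vertex is determined by its integer coordinates, and a path along the
    lift by its sides on the squares of the lift; only the identity of H_n maps
    such a side to another side of the same squares. *)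
Lemma goes_around_tour rho : goes_around v pos rho -> size rho = NV /\ exists m,
  (forall j, vtx rho j = gp (V (m + j))) \/
  (forall j, (j <= m + NV)%N -> vtx rho j = gp (V (m + NV - j))).
Proof.
case=> [[sides onto] self tree along]; set N := size rho.
have N0 : (0 < N)%N.
  have [|j [[lj _] _]] := onto (gp (0, 0)) (gp (1, 0)); last by apply: leq_trans lj.
  by apply/grid_sideP; exists (0, 0), (1, 0).
have vm j : vtx rho (j %% N) = vtx rho j by rewrite /vtx modn_mod.
have vmS j : vtx rho (j %% N).+1 = vtx rho j.+1.
  by rewrite -vm -[RHS]vm -(addn1 (j %% N)) -(addn1 j) modnDml.
have vmSS j : vtx rho (j %% N).+2 = vtx rho j.+2.
  by rewrite -vm -[RHS]vm -(addn2 (j %% N)) -(addn2 j) modnDml.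
have lm j : (j %% N < N)%N by rewrite ltn_mod.
pose U j := grid_coord (vtx rho j).
have sideU j : vtx rho j = gp (U j) /\ adj (U j) (U j.+1).
  have := sides _ (lm j); rewrite vm vmS => /grid_sideP [p [q [e1 e2 H]]].
  by rewrite /U e1 e2 !gpK.
have vU j : vtx rho j = gp (U j) by case: (sideU j).
have idH : inHn (size v) (@id R[i]).
  by apply/inHnP; exists one; [apply: dv0 | move=> z; rewrite ev_one].
have Ualong j : exists w k, inEv v w /\ side_at kf U j w k.
  have [w [Hw]] := along _ (lm j); rewrite (posE Hw) vm vmS !vU.
  move=> /corner_cp [l /gp_inj el] /corner_cp [m /gp_inj em]; exists w.
  have [_ /adj_side [k [a [_ H]]]] := sideU j; exists k; split=> //.
  have S (x y : nat) : cp k a = cp x (hp w) -> cp k.+1 a = cp y (hp w) -> a = hp w.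
    move=> e1 e2; apply: (@side_sq k).
      by rewrite e1; apply: (eq_mod4 (fun k => cp_mod k _)); rewrite (cp_class e1).
    by rewrite e2; apply: (eq_mod4 (fun k => cp_mod k _)); rewrite (cp_class e2).
  case: H => [[e1 e2]|[e1 e2]].
    by left; rewrite -(S l m) -?e1 -?e2.
  by right; rewrite -(S m l) -?e1 -?e2.
have Uinj i j : (U i = U j /\ U i.+1 = U j.+1) \/ (U i = U j.+1 /\ U i.+1 = U j) ->
    i = j %[mod N].
  move=> H; have [x [_ ux]] := onto _ _ (sides _ (lm j)).
  have xj : x = (j %% N)%N by apply: ux; split=> //; exists id; split=> //; left.
  rewrite -[RHS]xj; apply/esym/ux; split=> //; exists id; split=> //.
  by rewrite !vm !vmS !vU; case: H => [[-> ->]|[-> ->]]; [left|right].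
have Uonto w k : inEv v w -> exists j, side_at kf U j w k.
  move=> Hw; have [|j [[lj [f [/inHnP [g Hg fE] H]]] _]] :=
    onto (gp (cp k (hp w))) (gp (cp k.+1 (hp w))).
    by apply/grid_sideP; exists (cp k (hp w)), (cp k.+1 (hp w)); split=> //; apply: adj_cp.
  rewrite !fE !vU !ev_gp in H; exists j.
  have [w' [l [Hw' S]]] := Ualong j.
  have Q : mul (hp w') g = hp w -> side_at kf U j w k.
    move=> e; have ew : w' = w.
      by apply: (hp_inj Hkf Hw' Hw Hg (dv0 _) (f' := one)); rewrite mul1.
    have g1 : g = one by apply: (@mul_fix (hp w)); rewrite -[in RHS]e ew.
    have a1 p : af g p = p by rewrite g1; case: p => x y; rewrite /af /= !mulr0 !addr0.
    by case: H; rewrite !a1 => -[/gp_inj e1 /gp_inj e2]; [left|right].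
  case: S H => [[-> ->]|[-> ->]]; rewrite -!cp_mul => -[] [/gp_inj e1 /gp_inj e2].
  - by apply: Q; case: (side_sq_mod e1 e2).
  - by case: (side_orient e1 e2).
  - by case: (side_orient e2 e1).
  - by apply: Q; case: (side_sq_mod e2 e1).
have [] := @unique_tour v kf N U Hkf N0 _ Ualong Uonto Uinj.
- by move=> j; rewrite /U -vm modnDr vm.
- move=> i j ne e; have := self (i %% N)%N (j %% N)%N id (lm i) (lm j) ne idH.
  rewrite !vm !vmS !vmSS !vU => /(_ (congr1 gp e)).
  by rewrite !gp_qv crosses_qv !dblB.
- move=> i w k Hw ne e; have [g [h [n eg]]] := gk_names ne.
  have := tree (i %% N)%N w g id (lm i); rewrite !vm !vmS !vmSS !vU.
  have -> : act g w = gk k w by rewrite eg.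
  rewrite (posE Hw) (posE (gk_inEv k Hw)) hp_edge // !ev_ctr => /(_ _ idH) H.
  have {H} := H _ _; rewrite !gp_qv crosses_qv !dblB e ctr_rot; apply.
    by split=> //; [exists h | rewrite eg; apply/eqP].
  by rewrite -gp_qv; apply/on_edge_mid.
by move=> eN [m Hm]; split=> //; exists m; case: Hm => Hm; [left|right] => *; rewrite vU Hm.
Qed.

Lemma nth_rot_vtx (s : seq R[i]) k i : (k <= size s)%N -> (i < size s)%N ->
  nth 0 (rot k s) i = vtx s (i + k).
Proof.
move=> lk li; rewrite /vtx /rot nth_cat size_drop; move: (size s) lk li (erefl (size s)).
move=> n lk li en; case: ltnP => H; first by rewrite nth_drop modn_small 1?addnC // -ltn_subRL.
rewrite nth_take; last by lia.
congr nth; have -> : (i + k = (i - (n - k)) + n)%N by lia.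
by rewrite modnDr modn_small; lia.
Qed.

Lemma rot_tour (s : seq R[i]) m : size s = NV ->
  (forall j, vtx s j = gp (V (m + j))) -> exists k, tour = rot k s.
Proof.
move=> es H; have N0 := N_gt0 v.
have lm : (m %% NV < NV)%N by rewrite ltn_mod.
have em := divn_eq m NV.
exists (NV - m %% NV)%N; apply: (@eq_from_nth _ 0); first by rewrite size_rot size_mkseq.
rewrite size_mkseq => i li; rewrite nth_rot_vtx ?es //; last by lia.
rewrite H nth_mkseq //; congr gp.
have -> : (m + (i + (NV - m %% NV)) = (m %/ NV).+1 * NV + i)%N.
  by rewrite {1}em mulSn; lia.
rewrite -(periodic_mod (_ + i) (V_period v kf)) modnMDl.
by rewrite (periodic_mod i (V_period v kf)).
Qed.

Lemma goes_around_rot rho : goes_around v pos rho ->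
  exists k, tour = rot k rho \/ tour = rot k (rev rho).
Proof.
move=> /goes_around_tour [es [m [H|H]]].
  by have [k e] := rot_tour es H; exists k; left.
have N0 := N_gt0 v.
have [|j|k e] := @rot_tour (rev rho) m.+1; first by rewrite size_rev.
  rewrite -[in RHS](periodic_mod _ (V_period v kf)) -modnDmr.
  rewrite (periodic_mod _ (V_period v kf)) /vtx size_rev es.
  have := ltn_pmod j N0; move: (j %% NV)%N => i li.
  have := H (NV - i.+1)%N; rewrite /vtx es modn_small; last by lia.
  rewrite nth_rev ?es // => ->; last by lia.
  by congr (gp (V _)); lia.
by exists k; right.
Qed.

End Bridge.

(** * Comparison of broken lines by their turns *)

Section Turns.

Variable R : realType.
Local Notation C := R[i].

Lemma turn_norm X : `|turn R X| = 1.
Proof. by case: X; rewrite /turn ?normrN normCi. Qed.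

Lemma turn_flip X : turn R (flip X) * turn R X = 1.
Proof. by case: X; rewrite /turn /= ?mulNr ?mulrN -expr2 sqrCi opprK. Qed.

Lemma turn_sqr X : turn R X * turn R X = -1.
Proof. by case: X; rewrite /turn ?mulrNN -expr2 sqrCi. Qed.

(** The turns and the length of the sides determine a path up to isometry. *)
Lemma isometry_of_turns (P Q : nat -> C) (t : nat -> side) N :
  P 1 - P 0 != 0 -> `|Q 1 - Q 0| = `|P 1 - P 0| ->
  (forall j, (j.+2 <= N)%N -> P j.+2 - P j.+1 = turn R (t j) * (P j.+1 - P j)) ->
  (forall j, (j.+2 <= N)%N -> Q j.+2 - Q j.+1 = turn R (t j) * (Q j.+1 - Q j)) ->
  exists f : C -> C, (forall z w, `|f z - f w| = `|z - w|) /\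
    forall j, (j <= N)%N -> f (P j) = Q j.
Proof.
move=> nz eQP HP HQ.
pose u := (Q 1 - Q 0) / (P 1 - P 0).
have u1 : `|u| = 1 by rewrite normrM normfV eQP divff ?normr_eq0.
have D j : (j.+1 <= N)%N -> Q j.+1 - Q j = u * (P j.+1 - P j).
  elim: j => [|j IH] lj; first by rewrite divfK.
  by rewrite HQ // HP // IH 1?ltnW // mulrCA.
exists (fun z => u * (z - P 0) + Q 0); split=> [z w|j].
  by rewrite opprD addrACA subrr addr0 -mulrBr opprB addrA subrK normrM u1 mul1r.
elim: j => [|j IH] lj; first by rewrite subrr mulr0 add0r.
by rewrite -[RHS](subrK (Q j)) D // -IH 1?ltnW // addrA -mulrDr addrA subrK.
Qed.

Lemma gpB p q : gp R p - gp R q = gp R (p - q).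
Proof. by apply: complexP; rewrite /= intrB; lra. Qed.

Lemma gp_rot X p : gp R (rot90 X p) = turn R X * gp R p.
Proof.
by case: X; case: p => x y; rewrite /turn /gp; simpc; rewrite /= ?mulrNz ?mulNr.
Qed.

Lemma tour_turns v kf j : gp R (V v kf j.+2) - gp R (V v kf j.+1) =
  turn R (fold_turn (sL :: v) j) * (gp R (V v kf j.+1) - gp R (V v kf j)).
Proof. by rewrite !gpB V_turn gp_rot trnE. Qed.

Definition line (p d : C) (t : seq side) : seq C := p :: broken_line p d t.

Lemma line_cons p d X t : line p d (X :: t) = p :: line (p + d) (turn R X * d) t.
Proof. by []. Qed.

Lemma size_line p d t : size (line p d t) = (size t).+2.
Proof. by elim: t p d => [|X t IH] p d //; congr _.+1; apply: IH. Qed.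

Lemma nth_line0 p d t : nth 0 (line p d t) 0 = p.
Proof. by []. Qed.

Lemma nth_line1 p d t : nth 0 (line p d t) 1 = p + d.
Proof. by case: t. Qed.

Lemma line_turn p d t j : (j < size t)%N ->
  nth 0 (line p d t) j.+2 - nth 0 (line p d t) j.+1 =
  turn R (nth sL t j) * (nth 0 (line p d t) j.+1 - nth 0 (line p d t) j).
Proof.
elim: t p d j => [|X t IH] p d [|j] // lj.
  have -> : nth 0 (line p d (X :: t)) 2 = p + d + turn R X * d by exact: nth_line1.
  rewrite nth_line1 nth_line0 [p + d + _]addrC addrK.
  by rewrite [p + d]addrC addrK.
by rewrite !line_cons; apply: IH.
Qed.

Lemma line_last p d t :
  nth 0 (line p d t) (size t).+1 - nth 0 (line p d t) (size t) =
  \prod_(X <- t) turn R X * d.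
Proof.
elim: t p d => [|X t IH] p d; first by rewrite /= big_nil mul1r addrAC subrr add0r.
by rewrite big_cons [turn R X * _]mulrC -mulrA; apply: IH.
Qed.

(** The bends on the two sides of the middle one cancel. *)
Lemma prod_bends v X : \prod_(Y <- bends (rcons v X)) turn R Y = turn R X.
Proof.
rewrite bends_rcons big_cat big_cons /=.
have -> : \prod_(Y <- rev (map flip (bends v))) turn R Y =
          \prod_(Y <- bends v) turn R (flip Y).
  by rewrite (perm_big _ (permEl (perm_rev _))) big_map.
by rewrite mulrCA -big_split /= big1 ?mulr1 // => Y _; rewrite mulrC turn_flip.
Qed.

Section Folded.

Variables (u : seq side) (X : side).
Local Notation M := (2 ^ (size u).+1)%N.
Local Notation L := (line 0 (1 / 2) (bends (rcons u X))).
Local Notation e := (nth 0 L M).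

(** Both the line and its rotated copy are indexed from 0 to M, with the endpoints
    in common, so that the index 2 * M also makes sense and gives the vertex 0. *)
Definition closed_vertex (j : nat) : C :=
  if (j <= M)%N then nth 0 L j else e - nth 0 L (j - M).

Lemma size_bends_rcons : size (bends (rcons u X)) = M.-1.
Proof. by rewrite -(size_rcons u X) -size_bends. Qed.

Let M1 : (1 < M)%N.
Proof. by rewrite expnS; have := expn_gt0 2 (size u); lia. Qed.

Let size_L : size L = M.+1.
Proof. by rewrite size_line size_bends_rcons; lia. Qed.

Lemma closed_vertexE : folded_closed R (rcons u X) = mkseq closed_vertex M.*2.
Proof.
rewrite /folded_closed /folded; set b := broken_line _ _ _.
have eL : L = rcons (belast 0 b) (last 0 b) by rewrite -lastI.
have sb : size (belast 0 b) = M by have := size_L; rewrite eL size_rcons => -[].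
have ee : last 0 b = e by rewrite eL nth_rcons sb ltnn eqxx.
have nb j : (j < M)%N -> nth 0 (belast 0 b) j = nth 0 L j.
  by move=> lj; rewrite eL nth_rcons sb lj.
apply: (@eq_from_nth _ 0); first by rewrite size_mkseq size_cat size_map sb addnn.
rewrite size_cat size_map sb addnn => j lj; rewrite nth_mkseq // nth_cat sb /closed_vertex.
case: (ltngtP j M) => H; first by rewrite nb.
  rewrite (nth_map 0) ?sb ?nb ?ee //; lia.
by rewrite H subnn (nth_map 0) ?sb ?nb ?ee ?nth_line0 ?subr0 //; lia.
Qed.

Definition closed_turn (j : nat) : side :=
  nth sL (rcons (bends (rcons u X)) X) (j %% M).

Lemma closed_vertex_turn j : (j.+2 <= M.*2)%N ->
  closed_vertex j.+2 - closed_vertex j.+1 =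
  turn R (closed_turn j) * (closed_vertex j.+1 - closed_vertex j).
Proof.
have sub (a b c : C) : a - b - (a - c) = c - b.
  by rewrite opprB addrC addrA subrK.
have T i : (i.+1 < M)%N -> nth 0 L i.+2 - nth 0 L i.+1 =
    turn R (nth sL (rcons (bends (rcons u X)) X) i) * (nth 0 L i.+1 - nth 0 L i).
  move=> li; have lb : (i < size (bends (rcons u X)))%N by rewrite size_bends_rcons; lia.
  by rewrite line_turn // nth_rcons lb.
have c1 i : (i <= M)%N -> closed_vertex i = nth 0 L i by rewrite /closed_vertex => ->.
have c2 i : (M <= i)%N -> closed_vertex i = e - nth 0 L (i - M).
  rewrite leq_eqVlt => /orP [/eqP <-|li]; last by rewrite /closed_vertex leqNgt li.
  by rewrite c1 // subnn nth_line0 subr0.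
rewrite /closed_turn => lj; have [l1|] := ltnP j.+1 M.
  have l2 : (j < M)%N by apply: ltnW.
  by rewrite (c1 j.+2) // (c1 j.+1) // (c1 j) 1?ltnW // modn_small // T.
rewrite leq_eqVlt => /orP [/eqP e1|l1].
  (* The rotated copy starts in the direction opposite to that of the strip. *)
  have sb : size (bends (rcons u X)) = j by rewrite size_bends_rcons e1.
  have ll : e - nth 0 L j = turn R X * (1 / 2).
    by have := line_last 0 (1 / 2) (bends (rcons u X)); rewrite sb -e1 prod_bends.
  have -> : closed_vertex j.+1 = e by rewrite -e1 c1.
  have lj2 : (j < M)%N by rewrite e1.
  have -> : closed_vertex j.+2 = e - nth 0 L (j.+2 - M) by apply: c2; rewrite e1.
  rewrite (c1 j) 1?ltnW // (modn_small lj2).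
  rewrite nth_rcons sb ltnn eqxx ll mulrA turn_sqr mulN1r.
  have -> : (j.+2 - M = 1)%N by rewrite e1 subSn // subnn.
  by rewrite nth_line1 add0r addrAC subrr add0r.
rewrite !c2; try lia.
have [i ei] : exists i, j = (M + i)%N by exists (j - M)%N; lia.
have -> : (j.+2 - M = i.+2)%N by lia.
have -> : (j.+1 - M = i.+1)%N by lia.
have -> : (j - M = i)%N by lia.
rewrite ei modnDl modn_small; last by lia.
by rewrite !sub; apply: oppr_inj; rewrite opprB -mulrN opprB T //; lia.
Qed.

Lemma closed_vertex_end : closed_vertex M.*2 = 0.
Proof.
rewrite /closed_vertex leqNgt (_ : (M < M.*2)%N) /=; last by have := M1; lia.
by rewrite -addnn addnK subrr.
Qed.

Lemma half_norm : `|1 / 2 : C| = 1 / 2.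
Proof. by rewrite ger0_norm // divr_ge0. Qed.

Lemma closed_vertex_side j : (j.+1 <= M.*2)%N ->
  `|closed_vertex j.+1 - closed_vertex j| = 1 / 2.
Proof.
elim: j => [|j IH] lj.
  have -> : closed_vertex 1 = 1 / 2 by rewrite /closed_vertex (ltnW M1) nth_line1 add0r.
  by rewrite (_ : closed_vertex 0 = 0) // subr0 half_norm.
by rewrite closed_vertex_turn // normrM turn_norm (IH (ltnW lj)) [LHS]mul1r.
Qed.

Lemma reverse_turn j : (j.+2 <= M.*2)%N ->
  closed_vertex (M.*2 - j.+2) - closed_vertex (M.*2 - j.+1) =
  turn R (flip (closed_turn (M.*2 - j.+2))) *
    (closed_vertex (M.*2 - j.+1) - closed_vertex (M.*2 - j)).
Proof.
move=> lj; have [i [-> -> -> li]] : exists i, [/\ (M.*2 - j.+2 = i)%N,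
    (M.*2 - j.+1 = i.+1)%N, (M.*2 - j = i.+2)%N & (i.+2 <= M.*2)%N].
  by exists (M.*2 - j.+2)%N; split; lia.
apply: oppr_inj; rewrite opprB -mulrN opprB closed_vertex_turn //.
by rewrite mulrA turn_flip mul1r.
Qed.

End Folded.

Lemma modn_reverse b j : (j.+2 <= b.+1.*2)%N -> ((b.+1.*2 - j.+2) %% b.+1 =
  if (j %% b.+1 < b)%N then b - (j %% b.+1).+1 else b)%N.
Proof.
have lr : (j %% b.+1 < b.+1)%N by rewrite ltn_mod.
rewrite {1 2}(divn_eq j b.+1); move: (j %/ b.+1)%N (j %% b.+1)%N lr => q r lr {j}.
case: q => [|[|q]]; rewrite ?mul0n ?mul1n ?add0n => lj; last by rewrite !mulSn in lj; lia.
  case: ltnP => H.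
    have -> : (b.+1.*2 - r.+2 = b.+1 + (b - r.+1))%N by lia.
    by rewrite modnDl modn_small //; lia.
  have -> : (b.+1.*2 - r.+2 = b)%N by lia.
  by rewrite modn_small.
rewrite ifT; last by lia.
have -> : (b.+1.*2 - (b.+1 + r).+2 = b - r.+1)%N by lia.
by rewrite modn_small //; lia.
Qed.

(** Walking backwards along the closed line reverses the order and the directions
    of the bends, and this only changes the bend of the first fold. *)
Lemma closed_turn_rev u j : (j.+2 <= (2 ^ (size u).+1).*2)%N ->
  flip (closed_turn u sR ((2 ^ (size u).+1).*2 - j.+2)) = fold_turn (rcons u sR) j.
Proof.
rewrite -fold_turnE -[sL]/(flip sR) -rev_bends /closed_turn.
set b := bends _; have <- : (size b).+1 = (2 ^ (size u).+1)%N.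
  by rewrite size_bends size_rcons.
move=> lj; rewrite modn_reverse // !nth_rcons size_rev size_map.
have lr : (j %% (size b).+1 < (size b).+1)%N by rewrite ltn_mod.
move: (j %% (size b).+1)%N lr => r; rewrite ltnS leq_eqVlt => /orP [/eqP ->|H].
  by rewrite !ltnn !eqxx.
have l2 : (size b - r.+1 < size b)%N by rewrite ltn_subrL (leq_ltn_trans _ H).
by rewrite !H l2 nth_rev ?size_map // (nth_map sL).
Qed.

Lemma mkseq_map (T : Type) (f : T -> T) (P Q : nat -> T) N :
  (forall j, (j <= N)%N -> f (P j) = Q j) -> map f (mkseq P N) = mkseq Q N.
Proof.
move=> H; rewrite /mkseq -map_comp; apply/eq_in_map => j /=.
by rewrite mem_iota add0n => /ltnW; apply: H.
Qed.

Lemma isometric_folded_tour v kf :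
  isometric (folded_closed R (sL :: v)) (tour R v kf).
Proof.
pose Q j := gp R (V v kf j).
have Q1 : `|Q 1 - Q 0| = 1 / 2.
  by apply/adj_norm; rewrite V_next; apply: adj_cp.
have nz (z : C) : `|z| = 1 / 2 -> z != 0.
  by move=> e; rewrite -normr_gt0 e divr_gt0.
have eV j := tour_turns v kf j.
have : size (sL :: v) = (size v).+1 by [].
rewrite -[folded_closed]/(folded_closed) /tour -/Q.
move: eV; case/lastP: (sL :: v) => [//|u X] eV; rewrite size_rcons => -[su].
rewrite closed_vertexE; set M := (2 ^ (size u).+1)%N.
have -> : (4 * 2 ^ size v = M.*2)%N by rewrite /M su expnS; lia.
have M0 : (0 < M)%N by rewrite expn_gt0.
case: X eV => eV.
  have [|||j lj|f [If Hf]] := @isometry_of_turns (closed_vertex u sL) Q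
    (fold_turn (rcons u sL)) M.*2.
  - by apply/nz/closed_vertex_side; lia.
  - by rewrite Q1 closed_vertex_side //; lia.
  - by move=> j lj; rewrite closed_vertex_turn // -fold_turnE.
  - exact: eV.
  by exists f; split=> //; exists 0%N; left; rewrite rot0; apply: mkseq_map.
pose P j := closed_vertex u sR (M.*2 - j).
have P1 : `|P 1 - P 0| = 1 / 2.
  rewrite /P subn0 subn1 -normrN opprB -[in closed_vertex _ _ M.*2](@prednK M.*2) ?double_gt0 //.
  by apply: closed_vertex_side; rewrite prednK ?double_gt0.
have [|||j lj|f [If Hf]] := @isometry_of_turns P Q (fold_turn (rcons u sR)) M.*2.
- exact: nz.
- by rewrite Q1 P1.
- by move=> j lj; rewrite /P reverse_turn // closed_turn_rev.
- exact: eV.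
exists f; split=> //; exists (M.*2 - 1)%N; right.
have sP : size (mkseq P M.*2) = M.*2 by rewrite size_mkseq.
have eP : mkseq (closed_vertex u sR) M.*2 = rev (rot 1 (mkseq P M.*2)).
  apply: (@eq_from_nth _ 0); first by rewrite size_rev size_rot !size_mkseq.
  rewrite size_mkseq => j lj; rewrite nth_mkseq // nth_rev ?size_rot ?sP //.
  rewrite nth_rot_vtx ?sP; try lia.
  rewrite /vtx sP addn1 subnSK //.
  case: j lj => [|j] lj.
    by rewrite subn0 modnn nth_mkseq ?double_gt0 // /P subn0 closed_vertex_end.
  by rewrite modn_small; [rewrite nth_mkseq /P; [congr closed_vertex|] |]; lia.
rewrite eP map_rev map_rot (mkseq_map Hf) rev_rot /rotr size_rev size_mkseq.
by [].
Qed.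

Lemma rot_rot_ex (T : Type) (s : seq T) a k : exists c, rot a (rot k s) = rot c s.
Proof.
have [lk|/ltnW/rot_oversize ->] := leqP k (size s); last by exists a.
have [la|/ltnW H] := leqP a (size s); first by eexists; apply: rot_add_mod.
by exists k; rewrite rot_oversize ?size_rot.
Qed.

Lemma isometric_rot (p q s : seq C) k : isometric p q ->
  q = rot k s \/ q = rot k (rev s) -> isometric p s.
Proof.
move=> [f [If [a Ha]]] Hq; exists f; split=> //.
have D (r : seq C) : (exists c, rot a (rot k r) = rot c r) /\
    (exists c, rot a (rev (rot k r)) = rot c (rev r)).
  by split; [|rewrite rev_rot]; apply: rot_rot_ex.
case: Hq Ha => -> [] ->.
- by have [[c ->] _] := D s; exists c; left.
- by have [_ [c ->]] := D s; exists c; right.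
- by have [[c ->] _] := D (rev s); exists c; right.
- by have [_ [c ->]] := D (rev s); exists c; left; rewrite revK.
Qed.

End Turns.

(* On [sL :: v] instead of v: see the comment of [folded_closed]. *)
Theorem corollary5p4 (R : realType) (v : seq side) :
  (exists pos : word -> R[i], is_lift v pos) /\
  (forall pos : word -> R[i], is_lift v pos ->
     (exists rho : seq R[i], goes_around v pos rho) /\
     (forall rho : seq R[i], goes_around v pos rho ->
        isometric (folded_closed R (sL :: v)) rho)).
Proof.
split; first by eexists; apply: is_lift_hl.
move=> pos /lift_hp [kf Hkf posE]; split.
  by exists (tour R v kf); apply: tour_goes_around.
move=> rho /(goes_around_rot Hkf posE) [k H].
by apply: isometric_rot H; apply: isometric_folded_tour.
Qed.
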